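(* Let $X,Y$ be real Hilbert spaces, $K:X\to Y$ linear and bounded, $G:X\to(-\infty,\infty]$ and $F^*:Y\to(-\infty,\infty]$ proper convex lower semicontinuous functions, and $Q:X\to\mathbb R$, $P^*:Y\to\mathbb R$ convex differentiable functions with Lipschitz continuous gradients, with respective Lipschitz constants $l_Q>0$ and $l_{P^*}>0$. Assume that the solution set $S$ of the saddle-point problem $$\min_{x\in X}\max_{y\in Y}\ G(x)+Q(x)+\langle Kx,y\rangle_Y-F^*(y)-P^*(y)$$ is nonempty. Let $(x_n,y_n)\subset X\times Y$ be generated by CRIPDA (defined in the context) with parameters $e,s_0,s_1,\nu_0,w\in[0,\infty)$ and $\tau,\sigma>0$ verifying $$0<w<1,\qquad 2s_1<s_0<e.$$ Suppose in addition that one of the following two conditions holds: (a) there is $\delta>\frac14\max\{l_Q,l_{P^*}\}$ such that $\tau,\sigma\in\left(0,\frac{w(1-w)}{\delta}\right)$ and $\|K\|^2<\left(\tau^{-1}-\frac{\delta}{w(1-w)}\right)\left(\sigma^{-1}-\frac{\delta}{w(1-w)}\right)$; (b) $0<\tau<\frac{w(1-w)}{l_Q}$, $0<\sigma<\frac{w(1-w)}{l_{P^*}}$ and $\|K\|^2<\left(\tau^{-1}-\frac{l_Q}{w(1-w)}\right)\left(\sigma^{-1}-\frac{l_{P^*}}{w(1-w)}\right)$. Write $\dot u_n=u_n-u_{n-1}$. Then: 1. $\|(\dot x_n,\dot y_n)\|_M^2=o(n^{-2})$, $\sum_nn\|(\dot x_n,\dot y_n)\|_M^2<\infty$, $\sum_nn^2\|(\dot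 x_{n+1}-\dot x_n,\dot y_{n+1}-\dot y_n)\|_M^2<\infty$; 2. $\|T(x_n,y_n)-(x_n,y_n)\|_M^2=o(n^{-2})$, $\sum_nn\|T(x_n,y_n)-(x_n,y_n)\|_M^2<\infty$; 3. there exists $(\bar x,\bar y)\in S$ such that $(x_n,y_n)\rightharpoonup(\bar x,\bar y)$ weakly in $X\times Y$.
   Context: $X\times Y$ carries the scalar product $((x_1,y_1)|(x_2,y_2))=\langle x_1,x_2\rangle_X+\langle y_1,y_2\rangle_Y$. Solutions of the saddle-point problem are the pairs $(x,y)$ satisfying the optimality condition $0\in(A+B)(x,y)$, where $$A(x,y)=\left(\partial G(x)+K^*y\right)\times\left(-Kx+\partial F^*(y)\right),\qquad B(x,y)=(\nabla Q(x),\nabla P^*(y)).$$ Define on $X\times Y$ the linear map $M(x,y)=(\tau^{-1}x-K^*y,\ -Kx+\sigma^{-1}y)$, $\|\zeta\|_M=\sqrt{(M\zeta|\zeta)}$, and $T=(M+A)^{-1}\circ(M-B)$. For a proper convex lower semicontinuous $g$, $\mathrm{prox}_{\tau g}(x)=\mathrm{argmin}_u\{g(u)+\frac1{2\tau}\|x-u\|^2\}$. CRIPDA (corrected relaxed inertial primal-dual algorithm): choose $(\xi_{-1},\chi_{-1}),(x_{-1},y_{-1}),(x_0,y_0)\in X\times Y$ arbitrarily, set $\nu_n=s_1n+\nu_0$, $\theta_n=1-\frac{e+s_1}{e+\nu_{n+1}}$, $\gamma_n=1-\frac{s_0}{e+\nu_{n+1}}$, and for $n\ge0$ compute $$\xi_n=x_n+\theta_n(x_n-x_{n-1})+\gamma_n(\xi_{n-1}-x_n),\qquad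 \chi_n=y_n+\theta_n(y_n-y_{n-1})+\gamma_n(\chi_{n-1}-y_n),$$ $$x_{n+1}=(1-w)\xi_n+w\,\mathrm{prox}_{\tau G}\left(\xi_n-\tau(\nabla Q(\xi_n)+K^*\chi_n)\right),$$ $$\bar\xi_n=2w^{-1}\left(x_{n+1}-(1-w)\xi_n\right)-\xi_n,$$ $$y_{n+1}=(1-w)\chi_n+w\,\mathrm{prox}_{\sigma F^*}\left(\chi_n-\sigma(\nabla P^*(\chi_n)-K\bar\xi_n)\right).$$ Equivalently, $(x_{n+1},y_{n+1})=(1-w)(\xi_n,\chi_n)+wT(\xi_n,\chi_n)$.
   Formalization: The theorem is proved for s_1 > 0 instead of s_1 ≥ 0: for s_1 = 0 the iteration can reduce to plain Krasnoselskii–Mann, for which the claimed summability in 2 fails in infinite dimensions. *)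

(* Defs.v *)
From HB Require Import structures.
From mathcomp Require Import all_boot all_order all_algebra.
From mathcomp Require Import all_classical all_reals all_analysis.

Set Implicit Arguments.
Unset Strict Implicit.
Unset Printing Implicit Defensive.

Import Order.TTheory GRing.Theory Num.Theory.
Import numFieldNormedType.Exports.

Local Open Scope classical_set_scope.
Local Open Scope ring_scope.

(* Real Hilbert spaces: complete normed modules whose norm derives from a
   scalar product (a positive definite symmetric bilinear form). *)
HB.mixin Record isHilbert (R : realType) V of CompleteNormedModule R V := {
  hdot : {dot V for (@idfun R)};
  hdotE : forall x : V, hdot x x = `|x| ^+ 2
}.

#[short(type="hilbertType")]
HB.structure Definition Hilbert (R : realType) :=
  {V of isHilbert R V & CompleteNormedModule R V}.

Notation "''[' x , y ]" := (hdot x y) : ring_scope.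

Definition opnorm (R : realType) (X Y : normedModType R) (K : X -> Y) : R :=
  sup [set `|K x| | x in [set x : X | `|x| <= 1]].

(* Partial or set-valued constructions (adjoint, gradient, prox, inverse of a
   set-valued map) are turned into functions with `get`; the value is arbitrary
   when the defining set is empty. *)
Definition adjoint (R : realType) (X Y : hilbertType R) (K : X -> Y) (y : Y) : X :=
  get [set z : X | forall x, '[K x, y] = '[x, z]].

Definition grad (R : realType) (X : hilbertType R) (f : X -> R) (x : X) : X :=
  get [set g : X | forall v, 'd (f : X -> R^o) x v = '[g, v]].

Local Open Scope ereal_scope.

(* proper with values in ]-oo, +oo] *)
Definition proper_efun (R : realType) (X : Type) (g : X -> \bar R) : Prop :=
  (forall x, -oo < g x) /\ (exists x, g x < +oo).

Definition convex_efun (R : realType) (X : lmodType R) (g : X -> \bar R) : Prop :=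
  forall (t : R) (x y : X), (0 < t < 1)%R ->
    g (t *: x + (1 - t) *: y)%R <= t%:E * g x + (1 - t)%:E * g y.

Definition subdiff (R : realType) (X : hilbertType R) (g : X -> \bar R) (x : X)
  : set X := [set p | forall u, g x + ('[p, u - x])%:E <= g u].

Definition prox (R : realType) (X : hilbertType R) (t : R) (g : X -> \bar R)
    (x : X) : X :=
  let obj u := g u + ((2 * t)^-1 * `|x - u| ^+ 2)%:E in
  get [set u | forall v, obj u <= obj v].

Local Close Scope ereal_scope.

Section saddle_point.
Variables (R : realType) (X Y : hilbertType R) (K : X -> Y).

(* The norm of the product normed module X * Y is the max norm; the Hilbert
   structure of X * Y is given by the scalar product pdot, which induces the
   same topology. *)
Definition pdot (z1 z2 : X * Y) : R := '[z1.1, z2.1] + '[z1.2, z2.2].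

Definition opA (G : X -> \bar R) (Fs : Y -> \bar R) (z : X * Y) : set (X * Y) :=
  [set p + adjoint K z.2 | p in subdiff G z.1] `*`
  [set - K z.1 + q | q in subdiff Fs z.2].

Definition opB (Q : X -> R) (Ps : Y -> R) (z : X * Y) : X * Y :=
  (grad Q z.1, grad Ps z.2).

Definition saddle_sol (G : X -> \bar R) (Fs : Y -> \bar R) (Q : X -> R)
    (Ps : Y -> R) : set (X * Y) :=
  [set z | [set a + opB Q Ps z | a in opA G Fs z] 0].

Definition opM (tau sigma : R) (z : X * Y) : X * Y :=
  (tau^-1 *: z.1 - adjoint K z.2, - K z.1 + sigma^-1 *: z.2).

Definition normM (tau sigma : R) (z : X * Y) : R :=
  Num.sqrt (pdot (opM tau sigma z) z).

Definition opT (tau sigma : R) (G : X -> \bar R) (Fs : Y -> \bar R)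
    (Q : X -> R) (Ps : Y -> R) (z : X * Y) : X * Y :=
  get [set t | [set opM tau sigma t + a | a in opA G Fs t]
                 (opM tau sigma z - opB Q Ps z)].

End saddle_point.

(* u_{n-1}, where um1 stands for u_{-1} *)
Definition prevseq (V : Type) (um1 : V) (u : nat -> V) (n : nat) : V :=
  if n is k.+1 then u k else um1.

(* u_n - u_{n-1} *)
Definition dotseq (V : zmodType) (um1 : V) (u : nat -> V) (n : nat) : V :=
  u n - prevseq um1 u n.

Definition nu (R : realType) (s1 nu0 : R) (n : nat) : R := s1 * n%:R + nu0.

Definition theta (R : realType) (e s1 nu0 : R) (n : nat) : R :=
  1 - (e + s1) / (e + nu s1 nu0 n.+1).

Definition gamma (R : realType) (e s0 s1 nu0 : R) (n : nat) : R :=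
  1 - s0 / (e + nu s1 nu0 n.+1).

Definition cripda (R : realType) (X Y : hilbertType R) (K : X -> Y)
    (G : X -> \bar R) (Fs : Y -> \bar R) (Q : X -> R) (Ps : Y -> R)
    (e s0 s1 nu0 w tau sigma : R)
    (xim1 : X) (chim1 : Y) (xm1 : X) (ym1 : Y)
    (x xi : nat -> X) (y chi : nat -> Y) : Prop :=
  let th := theta e s1 nu0 in
  let ga := gamma e s0 s1 nu0 in
  forall n : nat,
  let xibar := (2 * w^-1) *: (x n.+1 - (1 - w) *: xi n) - xi n in
  [/\ xi n = x n + th n *: dotseq xm1 x n + ga n *: (prevseq xim1 xi n - x n),
      chi n = y n + th n *: dotseq ym1 y n + ga n *: (prevseq chim1 chi n - y n),
      x n.+1 = (1 - w) *: xi n +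
        w *: prox tau G (xi n - tau *: (grad Q (xi n) + adjoint K (chi n)))
    & y n.+1 = (1 - w) *: chi n +
        w *: prox sigma Fs (chi n - sigma *: (grad Ps (chi n) - K xibar))].

(* convergence in the weak topology, i.e. against continuous linear forms *)
Definition weakly_cvg (R : realType) (E : normedModType R) (u : nat -> E) (l : E)
  : Prop :=
  forall f : {linear E -> R^o}, continuous f -> f \o u @ \oo --> f l.

(* Main.v *)
Require Import Defs.
From HB Require Import structures.
From mathcomp Require Import all_boot all_order all_algebra.
From mathcomp Require Import all_classical all_reals all_analysis.
From mathcomp Require Import ring lra.

Set Implicit Arguments.
Unset Strict Implicit.
Unset Printing Implicit Defensive.

Import Order.TTheory GRing.Theory Num.Theory.
Import numFieldNormedType.Exports.

Local Open Scope classical_set_scope.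
Local Open Scope ring_scope.

(** In the metric of [M], the map [T] is nonexpansive and [U = id - T] is
    [(1 - w(1-w))]-cocoercive, by the Baillon-Haddad theorem and the bounds on
    [tau], [sigma]. Put [g_{n+1} = zeta_n - z_{n+1} = w U(zeta_n)] and
    [d_n = z_n - z_{n-1}]; since [1 - w(1-w) > w], the residual [g_n] behaves
    like a cocoercive operator evaluated at [z_n]:
    [<g_n, z_n - q> >= 0] for a solution [q] and
    [<g_{n+1} - g_n, d_{n+1}> >= rho |g_{n+1} - g_n|^2] with [rho > 0].
    CRIPDA reads [d_{n+1} + g_{n+1} = theta_n d_n + gamma_n g_n], a
    discretization of an inertial system with asymptotically vanishing damping.
    Its energy
      [lam (e |x|^2 + 2 <x, y>) + nu^2 |d|^2 / 2 + |y|^2 / 2],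
    where [x = z - q], [y = nu d + (nu + e + s1 - s0) g] and
    [lam = (e + s1) / 2], decreases; this gives the summability claims, and the
    [o(n^-2)] rates follow because [nu^2 |d|^2] and [|y|^2] have limits while
    their series with weights [1/n] converge. Then [|z_n - q|] converges for
    every solution [q], and Opial's argument gives the weak limit. *)

(** * Abstract scalar products: minimization, Riesz representation, weak limits *)

Record inner_product (R : realType) (H : lmodType R) (ip : H -> H -> R) :
    Prop := InnerProduct {
  ip_sym : forall x y, ip x y = ip y x;
  ip_addl : forall x y z, ip (x + y) z = ip x z + ip y z;
  ip_scalel : forall a x y, ip (a *: x) y = a * ip x y;
  ip_pos : forall x, 0 <= ip x x;
  ip_definite : forall x, ip x x = 0 -> x = 0
}.

(** The scalar product is a parameter because [X * Y] carries the max norm while the analysis takes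
    place in the metric of [M]; completeness is therefore phrased through [ip] alone. *)
Definition ip_complete (R : realType) (H : lmodType R) (ip : H -> H -> R) :=
  forall u : nat -> H,
  (forall eps : R, 0 < eps -> exists N, forall m n, (N <= m)%N -> (N <= n)%N ->
     ip (u m - u n) (u m - u n) <= eps) ->
  exists l, forall eps : R, 0 < eps -> exists N, forall n, (N <= n)%N ->
     ip (u n - l) (u n - l) <= eps.

Lemma inv_succ_small (R : realType) (eps : R) : 0 < eps ->
  exists N, forall n, (N <= n)%N -> n.+1%:R^-1 <= eps.
Proof.
move=> e0; have [N _ hN] := near_infty_natSinv_lt (PosNum e0).
by exists N => n /hN /= /ltW.
Qed.

(** The limit [t -> 0] in a bound affine in [t]; it stands in for derivatives in first-order
    optimality conditions. *)
Lemma ler_of_small (R : realType) (a b c : R) :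
  (forall t : R, 0 < t -> t < 1 -> a <= b + c * t) -> a <= b.
Proof.
move=> h; rewrite leNgt; apply/negP => ba.
have c0 : 0 < `|c| + 1 by have := normr_ge0 c; lra.
pose t := Num.min 2^-1 ((a - b) / 2 / (`|c| + 1)).
have tp : 0 < t.
  by rewrite lt_min; apply/andP; split; [lra|rewrite !divr_gt0 //; lra].
have t1 : t < 1 by rewrite gt_min; apply/orP; left; lra.
have t2 : t * (`|c| + 1) <= (a - b) / 2.
  by rewrite -ler_pdivlMr // ge_min lexx orbT.
have := h t tp t1; have : c * t <= t * (`|c| + 1).
  by have := ler_norm c; nra.
lra.
Qed.

Section InnerProduct.
Variables (R : realType) (H : lmodType R) (ip : H -> H -> R).
Hypothesis hip : inner_product ip.

Let ipC := ip_sym hip.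

Lemma ipDl x y z : ip (x + y) z = ip x z + ip y z. Proof. exact: ip_addl. Qed.
Lemma ipZl a x y : ip (a *: x) y = a * ip x y. Proof. exact: ip_scalel. Qed.
Lemma ipDr x y z : ip x (y + z) = ip x y + ip x z.
Proof. by rewrite ipC ipDl !(ipC x). Qed.
Lemma ipZr a x y : ip x (a *: y) = a * ip x y.
Proof. by rewrite ipC ipZl ipC. Qed.
Lemma ipNl x y : ip (- x) y = - ip x y.
Proof. by rewrite -scaleN1r ipZl mulN1r. Qed.
Lemma ipNr x y : ip x (- y) = - ip x y.
Proof. by rewrite -scaleN1r ipZr mulN1r. Qed.

Definition ipE := (ipDl, ipDr, ipNl, ipNr, ipZl, ipZr).

Lemma ip_cauchy_schwarz x y : (ip x y) ^+ 2 <= ip x x * ip y y.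
Proof.
have [/(ip_definite hip) ->|x0] := eqVneq (ip x x) 0.
  by rewrite -(scale0r 0) !ipE !mul0r expr0n.
have xp : 0 < ip x x by rewrite lt_neqAle eq_sym x0 ip_pos.
have := ip_pos hip (ip x x *: y - ip x y *: x); rewrite !ipE (ipC y x) => h.
rewrite -(ler_pM2l xp) -subr_ge0; apply: le_trans h _.
by rewrite le_eqVlt; apply/orP; left; apply/eqP; ring.
Qed.

Lemma ip_le_half x y : 2 * ip x y <= ip x x + ip y y.
Proof. by have := ip_pos hip (x - y); rewrite !ipE (ipC y x); lra. Qed.

Lemma ip_normD_le2 x y : ip (x + y) (x + y) <= 2 * ip x x + 2 * ip y y.
Proof. by have := ip_le_half x y; rewrite !ipE (ipC y x); lra. Qed.

Lemma ip_le_sqrt x y : ip x y <= Num.sqrt (ip x x) * Num.sqrt (ip y y).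
Proof.
rewrite -sqrtrM ?ip_pos //; apply: le_trans (ler_norm _) _.
by rewrite -sqrtr_sqr ler_sqrt ?ip_cauchy_schwarz // mulr_ge0 // ip_pos.
Qed.

Hypothesis hcomplete : ip_complete ip.

(* [A u r] is to be read as [Phi u <= r] for some function [Phi] which is
   never evaluated: this allows extended real values and upper limits. *)
Lemma epigraph_minimizer (A : H -> R -> Prop) (m k : R) : 0 < k ->
  (exists u (r : R), A u r) -> (forall u (r : R), A u r -> m <= r) ->
  (forall u v (r s : R), A u r -> A v s ->
     A (2^-1 *: (u + v)) ((r + s) / 2 - k * ip (u - v) (u - v))) ->
  (forall l (r : R), (forall eps : R, 0 < eps -> exists u (s : R),
     [/\ ip (u - l) (u - l) <= eps, s <= r + eps & A u s]) -> A l r) ->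
  exists l (r : R), A l r /\ forall u (s : R), A u s -> r <= s.
Proof.
move=> k0 [u0 [r0 A0]] Am Amid Acl.
pose S := [set r | exists u, A u r].
have Si : has_inf S.
  by split; [exists r0, u0|exists m => r [u /Am]].
have lbS u s : A u s -> inf S <= s.
  by move=> us; apply: ge_inf; [case: Si|exists u].
have /choice[f hf] n : exists p : H * R, A p.1 p.2 /\ p.2 < inf S + n.+1%:R^-1.
  have [|r [u ur] rlt] := @inf_adherent R S n.+1%:R^-1 _ Si.
    by rewrite invr_gt0.
  by exists (u, r).
(* The midpoint of two almost minimizers still has value at least [inf S], so [k |f p - f q|^2] is
   at most the mean of [1/(p+1)] and [1/(q+1)]: the minimizing sequence is Cauchy. *)
have [|l hl] := hcomplete (u := fun n => (f n).1).
  move=> eps e0; have [|N hN] := @inv_succ_small _ (k * eps).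
    by rewrite mulr_gt0.
  exists N => p q /hN hp /hN hq /=; rewrite -(ler_pM2l k0).
  have [Ap lp] := hf p; have [Aq lq] := hf q.
  move: (lbS _ _ (Amid _ _ _ _ Ap Aq)) lp lq hp hq.
  by move: (p.+1%:R^-1) (q.+1%:R^-1) => ip' iq'; lra.
exists l, (inf S); split=> //; apply: Acl => eps e0.
have [N1 h1] := hl _ e0; have [N2 h2] := inv_succ_small e0.
exists (f (maxn N1 N2)).1, (f (maxn N1 N2)).2.
have [An ln] := hf (maxn N1 N2).
split=> //; first by apply: h1; rewrite leq_maxl.
by move: ln (h2 _ (leq_maxr N1 N2)); move: (_.+1%:R^-1) => i; lra.
Qed.

(** The representer [l] minimizes [|u|^2 / 2 - f u]. Comparing it with [l + t *: y] as [t -> 0]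
    gives [f y <= <y, l>], and [- y] gives the converse. *)
Lemma riesz_representation (f : H -> R) (C : R) :
  (forall x y, f (x + y) = f x + f y) -> (forall a x, f (a *: x) = a * f x) ->
  (forall x, f x <= C * Num.sqrt (ip x x)) ->
  exists v, forall x, f x = ip x v.
Proof.
move=> fD fZ fC.
have fN x : f (- x) = - f x by rewrite -scaleN1r fZ mulN1r.
pose A u r := ip u u / 2 - f u <= r.
(* [- C^2 / 2] comes from completing the square in [|u|^2 / 2 - C |u|], and [1/8] from the
   parallelogram identity. *)
have [| | | | |l [r [Al lmin]]] :=
    @epigraph_minimizer A (- (C ^+ 2 / 2)) (8^-1).
- lra.
- by exists 0, (ip 0 0 / 2 - f 0); rewrite /A.
- move=> u r; apply: le_trans.
  have := fC u; have := sqr_sqrtr (ip_pos hip u).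
  set s := Num.sqrt _ => hs.
  have : 0 <= (s - C) ^+ 2 by exact: sqr_ge0.
  nra.
- rewrite /A => u v r s; rewrite !(fD, fZ) !ipE (ipC v u); lra.
- rewrite /A => l r h.
  apply: (@ler_of_small _ _ _ (Num.sqrt (ip l l) + `|C| + 1)) => t t0 t1.
  have [|u [s [h1 h2 h3]]] := h (t ^+ 2); first by rewrite exprn_gt0.
  have sq : Num.sqrt (ip (u - l) (u - l)) <= t.
    by rewrite -(ler_sqr (sqrtr_ge0 _)) ?nnegrE ?(ltW t0) // sqr_sqrtr ?ip_pos.
  have := fC (u - l); rewrite fD fN.
  have : - ip l (u - l) <= Num.sqrt (ip l l) * Num.sqrt (ip (u - l) (u - l)).
    by have := ip_le_sqrt l (- (u - l)); rewrite ipNl !ipNr opprK.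
  move: sq; set q := Num.sqrt (ip (u - l) (u - l)) => sq f2 f1.
  have q0 : 0 <= q by exact: sqrtr_ge0.
  have l0 : 0 <= Num.sqrt (ip l l) by exact: sqrtr_ge0.
  have := ip_pos hip (u - l); move: f2; rewrite !ipE (ipC u l) => f2 f3.
  have f4 : Num.sqrt (ip l l) * q <= Num.sqrt (ip l l) * t.
    by rewrite ler_wpM2l.
  have f5 : C * q <= `|C| * t.
    apply: le_trans (_ : `|C| * q <= _); first by rewrite ler_wpM2r ?ler_norm.
    by rewrite ler_wpM2l.
  nra.
exists l => x.
have key y : f y <= ip y l.
  apply: (@ler_of_small _ _ _ (ip y y / 2)) => t t0 t1.
  have := lmin (l + t *: y) _ (lexx _); have := Al.
  rewrite /A !(fD, fZ) !ipE (ipC l y) => h1 h2.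
  by rewrite -(ler_pM2l t0); nra.
apply/eqP; rewrite eq_le key /=.
by have := key (- x); rewrite fN ipNl lerN2.
Qed.

(* Weak limits are found as asymptotic centers, the minimizers of
   [limsup |u n - _|^2]: this avoids weak compactness. *)
Definition asymptotic_radius_le (J : nat -> Prop) (u : nat -> H) (c : H) (r : R) :=
  forall eps : R, 0 < eps -> exists N, forall n, (N <= n)%N -> J n ->
    ip (u n - c) (u n - c) <= r + eps.

(** All functions [|u n - _|^2] share the convexity modulus [1/4], so their upper limit along [J]
    inherits it; it is nonnegative because [J] is infinite. *)
Lemma asymptotic_center (J : nat -> Prop) (u : nat -> H) (B : R) :
  (forall N, exists2 n, (N <= n)%N & J n) -> (forall n, ip (u n) (u n) <= B) ->
  exists c (r : R), asymptotic_radius_le J u c r /\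
    forall v (s : R), asymptotic_radius_le J u v s -> r <= s.
Proof.
move=> Jinf uB; apply: (@epigraph_minimizer _ 0 4^-1); first by lra.
- exists 0, B => eps e0; exists 0%N => n _ _; rewrite subr0.
  by have := uB n; lra.
- move=> v r h; apply: (@ler_of_small _ _ _ 1) => t t0 _.
  have [N hN] := h t t0; have [n Nn Jn] := Jinf N.
  by have := hN n Nn Jn; have := ip_pos hip (u n - v); lra.
- move=> c v r s hc hv eps e0.
  have [N1 h1] := hc _ e0; have [N2 h2] := hv _ e0.
  exists (maxn N1 N2) => n; rewrite geq_max => /andP[n1 n2] Jn.
  have := h1 n n1 Jn; have := h2 n n2 Jn.
  rewrite !ipE (ipC v c) (ipC c (u n)) (ipC v (u n)); lra.
- move=> l r h eps e0.
  pose D := 2 * B + 2 * ip l l.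
  have Dub n : ip (u n - l) (u n - l) <= D.
    have := ip_normD_le2 (u n) (- l); have := uB n.
    by rewrite /D ipNl ipNr; lra.
  have D0 : 0 <= D := le_trans (ip_pos hip _) (Dub 0%N).
  pose t := Num.min (eps / 4) (eps / (4 * (D + 1))).
  have t0 : 0 < t.
    rewrite lt_min !divr_gt0 //; lra.
  have t1 : t <= eps / 4 by rewrite ge_min lexx.
  have t2 : t * (D + 1) <= eps / 4.
    rewrite -ler_pdivlMr; last lra.
    by rewrite ge_min -mulrA -invfM lexx orbT.
  (* The tolerance is the minimum of [t^2] and [t]: the first controls [|c - l|^2 / t] in Young's
     inequality, the second the excess of [s] over [r]. *)
  have [|c [s [h1 h2 h3]]] := h (t ^+ 2 * Num.min 1 t^-1).
    by rewrite mulr_gt0 ?exprn_gt0 // lt_min ltr01 invr_gt0.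
  have a1 : t ^+ 2 * Num.min 1 t^-1 <= t ^+ 2.
    by rewrite ler_piMr ?sqr_ge0 // ge_min lexx.
  have a2 : t ^+ 2 * Num.min 1 t^-1 <= t.
    rewrite (le_trans (_ : _ <= t ^+ 2 * t^-1)) //.
      by rewrite ler_wpM2l ?sqr_ge0 // ge_min lexx orbT.
    by rewrite expr2 mulfK // gt_eqF.
  have [|N hN] := h3 (eps / 4); first lra.
  exists N => n Nn Jn; have := hN n Nn Jn => h4.
  have h5 := Dub n.
  have : 2 * ip (u n - l) (c - l) <= t * ip (u n - l) (u n - l) +
      t^-1 * ip (c - l) (c - l).
    rewrite -(ler_pM2l t0) mulrDr (mulrA t t^-1) divff ?gt_eqF // mul1r.
    have := ip_le_half (t *: (u n - l)) (c - l).
    by rewrite ipZl ipZl ipZr; lra.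
  have : t^-1 * ip (c - l) (c - l) <= t.
    by rewrite mulrC ler_pdivrMr // -expr2; lra.
  have : t * ip (u n - l) (u n - l) <= t * D by rewrite ler_wpM2l // ltW.
  have := ip_pos hip (c - l); move: h4 h5 h1.
  rewrite !ipE (ipC l (u n)) (ipC c (u n)) (ipC l c); nra.
Qed.

(** Centers of subsequences are fixed points: as [T] is nonexpansive with vanishing residual, the
    radius at [T c] is no larger than at [c], and unless [T c = c] the midpoint would do strictly
    better. This replaces demiclosedness and the extraction of weakly convergent subsequences. *)
Lemma opial_weak_limit (T : H -> H) (u : nat -> H) (B : R) :
  (forall n, ip (u n) (u n) <= B) ->
  (forall x y, ip (T x - T y) (T x - T y) <= ip (x - y) (x - y)) ->
  (fun n => ip (T (u n) - u n) (T (u n) - u n)) @ \oo --> (0 : R) ->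
  (forall q, T q = q ->
     exists l : R, (fun n => ip (u n - q) (u n - q)) @ \oo --> l) ->
  exists2 c, T c = c & forall v, (fun n => ip (u n) v) @ \oo --> ip c v.
Proof.
move=> uB Tne res lims.
have res_small (eps : R) : 0 < eps -> exists N, forall n, (N <= n)%N ->
    ip (T (u n) - u n) (T (u n) - u n) <= eps.
  move=> e0; move/cvgrPdist_le/(_ eps e0) : res => [N _ hN].
  by exists N => n /hN; rewrite sub0r normrN ger0_norm ?ip_pos.
have B0 : 0 <= B := le_trans (ip_pos hip _) (uB 0%N).
have fixc J c r : (forall N, exists2 n, (N <= n)%N & J n) ->
    asymptotic_radius_le J u c r ->
    (forall v (s : R), asymptotic_radius_le J u v s -> r <= s) -> T c = c.
  move=> Jinf hc cmin.
  have hTc : asymptotic_radius_le J u (T c) r.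
    move=> eps e0.
    pose D := 2 * B + 2 * ip c c + 1.
    have D0 : 0 < D by have := ip_pos hip c; rewrite /D; lra.
    have Dub n : ip (u n - c) (u n - c) <= D.
      have := ip_normD_le2 (u n) (- c); have := uB n.
      by rewrite /D ipNl ipNr; lra.
    pose t := Num.min 1 (eps / (4 * D)).
    have t0 : 0 < t by rewrite lt_min ltr01 divr_gt0 ?mulr_gt0.
    have t2 : t * D <= eps / 4.
      rewrite -ler_pdivlMr //.
      by rewrite ge_min -mulrA -invfM lexx orbT.
    have [|N1 h1] := hc (eps / 4); first lra.
    have [|N2 h2] := res_small (t * (eps / 4)).
      by rewrite mulr_gt0 //; lra.
    exists (maxn N1 N2) => n; rewrite geq_max => /andP[n1 n2] Jn.
    have k1 := h1 n n1 Jn; have k2 := h2 n n2; have k3 := Tne (u n) c.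
    have t1 : t <= 1 by rewrite ge_min lexx.
    pose p := T (u n) - T c; pose q := T (u n) - u n.
    have pq : u n - T c = p - q by rewrite /p /q opprB [RHS]addrC subrKA.
    rewrite pq.
    have k4 : - 2 * ip p q <= t * ip p p + t^-1 * ip q q.
      rewrite -(ler_pM2l t0) mulrDr (mulrA t t^-1) divff ?gt_eqF // mul1r.
      have := ip_pos hip (t *: p + q); move: (p) (q) => p' q'.
      by rewrite !ipE (ipC q' p'); lra.
    have k5 : t^-1 * ip q q <= eps / 4.
      by rewrite mulrC ler_pdivrMr // mulrC.
    have k6 : t * ip p p <= t * D.
      by rewrite ler_wpM2l ?(ltW t0) //; exact: le_trans k3 (Dub n).
    have k7 : ip q q <= eps / 4 by nra.
    have k8 : ip p p <= ip (u n - c) (u n - c) by [].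
    move: k1 k2 k4 k5 k6 k7 k8; clearbody p q; rewrite !ipE (ipC q p); lra.
  have mid : asymptotic_radius_le J u (2^-1 *: (c + T c))
      (r - 4^-1 * ip (c - T c) (c - T c)).
    move=> eps e0; have [N1 h1] := hc _ e0; have [N2 h2] := hTc _ e0.
    exists (maxn N1 N2) => n; rewrite geq_max => /andP[n1 n2] Jn.
    have := h1 n n1 Jn; have := h2 n n2 Jn.
    rewrite !ipE (ipC (T c) c) (ipC c (u n)) (ipC (T c) (u n)); lra.
  have := cmin _ _ mid; have := ip_pos hip (c - T c) => p1 p2.
  apply/esym/subr0_eq/(ip_definite hip); lra.
have Tinf : forall N, exists2 n, (N <= n)%N & True by move=> N; exists N.
have [c [r [hc cmin]]] := asymptotic_center Tinf uB.
exists c; first exact: fixc hc cmin.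
move=> v0.
(* A center for the indices where [u n - c] stays on one side of a hyperplane
   has the same radius as [c], and moving [c] to that side lowers it. *)
have half v (eps : R) : 0 < eps -> exists N, forall n, (N <= n)%N -> ip (u n - c) v < eps.
  move=> e0; apply: contrapT => nN.
  pose J n := eps <= ip (u n - c) v.
  have Jinf N : exists2 n, (N <= n)%N & J n.
    apply: contrapT => nJ; apply: nN; exists N => n Nn.
    by rewrite ltNge; apply/negP => Jn; apply: nJ; exists n.
  have [cJ [rJ [hcJ cJmin]]] := asymptotic_center Jinf uB.
  have [l hl] := lims _ (fixc _ _ _ Jinf hcJ cJmin).
  (* Since [cJ] is fixed, its squared distances converge to some [l] along the whole sequence:
     minimality of [r] gives [r <= l], and reading the limit along [J] gives [l <= rJ]. *)
  have rrJ : r <= rJ.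
    apply: le_trans (_ : r <= l) _.
      apply: (cmin cJ) => d d0; move/cvgrPdist_le/(_ d d0) : hl => [N _ hN].
      by exists N => n /hN h _; move: h; rewrite ler_distlC => /andP[]; lra.
    apply: (@ler_of_small _ _ _ 2) => d d0 _.
    have [N1 h1] := hcJ d d0; move/cvgrPdist_le/(_ d d0) : hl => [N2 _ h2].
    have [n] := Jinf (maxn N1 N2); rewrite geq_max => /andP[n1 n2] Jn.
    have := h1 n n1 Jn; have /= := h2 n n2.
    rewrite ler_distl => /andP[]; lra.
  pose V := ip v v; have V0 : 0 <= V by exact: ip_pos.
  (* With this [t], [t V < eps], so moving [c] by [t *: v] changes the radius along [J] by at most
     [- 2 t eps + t^2 V < 0], against [r <= rJ]. *)
  pose t := eps / (V + 1).
  have tV : t * (V + 1) = eps by rewrite /t divfK //; lra.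
  have t0 : 0 < t by rewrite /t divr_gt0 //; lra.
  have : rJ <= r - 2 * t * eps + t ^+ 2 * V.
    apply: (cJmin (c + t *: v)) => d d0; have [N hN] := hc d d0.
    exists N => n /hN /(_ I) h1; rewrite /J => h2.
    have : t * eps <= t * ip (u n - c) v by rewrite ler_wpM2l // ltW.
    move: h1; rewrite /V !ipE (ipC v (u n)) (ipC c (u n)) (ipC v c); nra.
  have : t * V < eps by nra.
  nra.
apply/cvgrPdist_lt => eps e0.
have [N1 h1] := half v0 _ e0; have [N2 h2] := half (- v0) _ e0.
exists (maxn N1 N2) => // n /=; rewrite geq_max => /andP[n1 n2].
have := h1 n n1; have := h2 n n2; rewrite !ipE ltr_norml => a1 a2.
by apply/andP; split; lra.
Qed.

End InnerProduct.

(** * Real sequences with bounded partial sums *)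

Section BoundedSums.
Variable R : realType.
Implicit Types u v h : nat -> R.

(** Only an upper bound is recorded, so comparison needs no sign condition; for nonnegative terms
    this is summability. *)
Definition bounded_sums u := exists B, forall N, \sum_(k < N) u k <= B.

Lemma bounded_sums_le u v : (forall n, u n <= v n) -> bounded_sums v ->
  bounded_sums u.
Proof.
by move=> uv [B hB]; exists B => N; apply: le_trans (hB N); apply: ler_sum.
Qed.

Lemma bounded_sumsD u v : bounded_sums u -> bounded_sums v ->
  bounded_sums (fun n => u n + v n).
Proof.
move=> [B hB] [C hC]; exists (B + C) => N.
by rewrite big_split lerD.
Qed.

Lemma bounded_sumsZ a u : 0 <= a -> bounded_sums u ->
  bounded_sums (fun n => a * u n).
Proof.
move=> a0 [B hB]; exists (a * B) => N.
by rewrite -mulr_sumr ler_wpM2l.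
Qed.

Lemma bounded_sums_shift u : bounded_sums (fun n => u n.+1) -> bounded_sums u.
Proof.
move=> [B hB]; exists (Num.max 0 (u 0%N + B)) => -[|N].
  by rewrite big_ord0 le_max lexx.
by rewrite big_ord_recl le_max lerD2l hB orbT.
Qed.

Lemma bounded_sums_unshift u : bounded_sums u -> bounded_sums (fun n => u n.+1).
Proof.
move=> [B hB]; exists (B - u 0%N) => N.
by have := hB N.+1; rewrite big_ord_recl; lra.
Qed.

Lemma bounded_sums_telescope u h m : (forall n, h n.+1 <= h n - u n) ->
  (forall n, m <= h n) -> bounded_sums u.
Proof.
move=> hu hm; exists (h 0%N - m) => N.
suff : \sum_(k < N) u k <= h 0%N - h N by have := hm N; lra.
elim: N => [|N IH]; first by rewrite big_ord0 subrr.
by rewrite big_ord_recr /=; have := hu N; lra.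
Qed.

(** Subtracting from [h] the partial sums of [u] leaves a nonincreasing sequence that is bounded
    below. *)
Lemma cvg_quasi_nonincreasing h u : (forall n, 0 <= h n) ->
  (forall n, 0 <= u n) -> bounded_sums u -> (forall n, h n.+1 <= h n + u n) ->
  exists l : R, h @ \oo --> l.
Proof.
move=> h0 u0 [B hB] hu.
pose S n := \sum_(k < n) u k.
have Sc : cvgn S.
  apply: nondecreasing_is_cvgn; last by exists B => _ [n _ <-]; exact: hB.
  by apply/nondecreasing_seqP => n; rewrite /S big_ord_recr /= lerDl.
have Tc : cvgn (h \- S).
  apply: nonincreasing_is_cvgn; last first.
    exists (- B) => _ [n _ <-] /=.
    by have := h0 n; have := hB n; rewrite /S; lra.
  apply/nonincreasing_seqP => n /=; rewrite /S big_ord_recr /=.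
  by have := hu n; lra.
exists (limn (h \- S) + limn S).
have {1}-> : h = (h \- S) \+ S by apply/funext => n /=; rewrite subrK.
exact: cvgD Tc Sc.
Qed.

(** If [l > 0], then eventually [h k >= l / 2], and the harmonic series would have bounded partial
    sums. *)
Lemma cvg0_of_harmonic_bounded_sums h (l : R) : (forall n, 0 <= h n) ->
  h @ \oo --> l -> bounded_sums (fun n => h n / n.+1%:R) -> h @ \oo --> (0 : R).
Proof.
move=> h0 hl [B hB].
suff l0 : l <= 0.
  have -> : 0 = l; last exact: hl.
  apply/eqP; rewrite eq_le l0 andbT.
  have <- : limn h = l by exact: cvg_lim hl.
  by apply: limr_ge; [apply/cvg_ex; exists l|exact: nearW].

rewrite leNgt; apply/negP => lp.
have l2 : 0 < l / 2 by rewrite divr_gt0.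
have [N _ hN] := (cvgrPdist_le _ _).1 hl _ l2.
apply: (@dvg_harmonic R); apply: nondecreasing_is_cvgn.
  by apply/nondecreasing_seqP => n; rewrite !seriesEnat /= big_nat_recr //= lerDl invr_ge0.
exists (\sum_(k < N) k.+1%:R^-1 + (l / 2)^-1 * B) => _ [n _ <-].
rewrite seriesEord /=.
suff : \sum_(k < n) (k.+1%:R^-1 : R) <= \sum_(k < N) k.+1%:R^-1 +
    (l / 2)^-1 * \sum_(k < n) h k / k.+1%:R.
  move=> /le_trans; apply; rewrite lerD2l ler_wpM2l ?hB //.
  by rewrite invr_ge0 ltW.
elim: n => [|n IH].
  by rewrite !big_ord0 mulr0 addr0 sumr_ge0 // => i _; rewrite invr_ge0.
have [nN|Nn] := ltnP n N.
  apply: le_trans (_ : \sum_(k < N) k.+1%:R^-1 <= _); last first.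
    rewrite lerDl mulr_ge0 ?invr_ge0 ?(ltW l2) //.
    by apply: sumr_ge0 => i _; rewrite divr_ge0.
  rewrite -(subnKC nN) [leRHS]big_split_ord /= lerDl.
  by apply: sumr_ge0 => i _; rewrite invr_ge0.
rewrite !big_ord_recr /= mulrDr addrA lerD // mulrA.
rewrite ler_peMl ?invr_ge0 // mulrC ler_pdivlMr // mul1r.
by have /= := hN n Nn; rewrite ler_distl => /andP[]; lra.
Qed.

Lemma eseries_lt_pinfty u : (forall n, 0 <= u n) -> bounded_sums u ->
  (\sum_(0 <= n <oo) (u n)%:E < +oo)%E.
Proof.
move=> u0 [B hB]; apply: le_lt_trans (_ : (B%:E < +oo)%E); last exact: ltry.
apply: lime_le; first by apply: is_cvg_nneseries => n _ _; rewrite lee_fin.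
by apply: nearW => n; rewrite sumEFin lee_fin big_mkord.
Qed.

Lemma littleo_inv_sqr u : (fun n => n%:R ^+ 2 * u n) @ \oo --> (0 : R) ->
  (u : nat -> R^o) =o_\oo (fun n => n%:R ^- 2 : R^o).
Proof.
move=> hu; apply/eqoP => eps e0.
have [N _ hN] := (cvgrPdist_le _ _).1 hu _ e0.
(* Starting at [N.+1] excludes [n = 0], where [n%:R ^- 2] takes the default value 0. *)
exists N.+1 => // n /= Nn.
have := hN n (ltnW Nn); rewrite sub0r normrN normrM => h.
have n0 : 0 < n%:R ^+ 2 :> R by rewrite exprn_gt0 // ltr0n (leq_ltn_trans _ Nn).
rewrite [`|_ ^- 2|]ger0_norm ?invr_ge0 ?sqr_ge0 // ler_pdivlMr // mulrC.
by rewrite -[X in X * _](ger0_norm (ltW n0)).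
Qed.

End BoundedSums.

(** * Lyapunov analysis of the inertial recursion *)

Section InertialDynamics.
Variables (R : realType) (H : lmodType R) (ip : H -> H -> R).
Hypothesis hip : inner_product ip.

Let ipC := ip_sym hip.

(** The coefficient of [g] is chosen so that the recursion turns this vector into [a *: (d' + g')],
    with [a = e + v + s1] and [d'], [g'] the next velocity and residual. *)
Definition shadow (e s0 s1 v : R) (d g : H) : H :=
  v *: d + (v + (e + s1 - s0)) *: g.

(* The weights [lam = (e + s1) / 2] and [1/2, 1/2] make the quadratic form in
   [d, g] of [energy_step] positive definite. *)
Definition energy (e s0 s1 v : R) (x d g : H) : R :=
  (e + s1) / 2 * (e * ip x x + 2 * ip x (shadow e s0 s1 v d g)) +
  v ^+ 2 * ip d d / 2 + ip (shadow e s0 s1 v d g) (shadow e s0 s1 v d g) / 2.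

(** With [h] the [g]-part of the shadow and [lam = (e + s1) / 2], remove the square
    [|v d + h / 2 + lam x|^2]: what remains is [|h|^2 / 4 + lam <x, h> + lam (e - lam) |x|^2]. *)
Lemma energy_ge (e s0 s1 v : R) (x d g : H) :
  0 <= v -> 0 < s1 -> s1 < s0 -> s0 < e -> 0 <= ip x g ->
  (e + s1) / 2 * ((e - s1) / 2) * ip x x <= energy e s0 s1 v x d g.
Proof.
move=> v0 s10 s1s0 s0e xg.
pose h := (v + (e + s1 - s0)) *: g.
have q1 := ip_pos hip (v *: d + 2^-1 *: h + ((e + s1) / 2) *: x).
have q2 := ip_pos hip h.
have q3 : 0 <= (e + s1) / 2 * ip x h.
  by rewrite /h (ipZr hip) !mulr_ge0 //; lra.
rewrite /energy /shadow -/h; move: q1 q2 q3; move: h => h.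
by rewrite !(ipE hip) (ipC h d) (ipC x d) (ipC x h); lra.
Qed.

Section Step.
Variables (e s0 s1 v : R) (x d g d' g' : H).
Let a := e + (v + s1).
Hypothesis step : v *: d = a *: (d' + g') - (a - s0) *: g.

(** An exact identity, found by eliminating [v *: d] through [step]. In the range of parameters used
    below every subtracted term is nonnegative once [<x + d', g'>] and [<d', g' - g>] are. *)
Lemma energy_step :
  energy e s0 s1 (v + s1) (x + d') d' g' = energy e s0 s1 v x d g
  - (e + s1) * (s0 - s1) * ip (x + d') g'
  - a * (a - s0) * ip d' (g' - g)
  - (2 * (v + s1) + e) *
     ((s0 - s1) / 2 * ip (d' + g') (d' + g') + (e - s0) / 2 * ip d' d')
  - (s0 - s1) * (e + s1 - s0) / 2 * ip g' g'
  - ip (s0 *: g' + (a - s0) *: (g' - g)) (s0 *: g' + (a - s0) *: (g' - g)) / 2.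
Proof.
rewrite /energy /shadow.
have -> : v ^+ 2 * ip d d = ip (v *: d) (v *: d).
  by rewrite !(ipE hip) mulrA.
rewrite step !(ipE hip) (ipC d' x) (ipC g' d') (ipC g d').
by rewrite (ipC g g') /a; field.
Qed.

(** The energy controls only a total; the rates need a limit for each of its parts, hence separate
    balances for the velocity and for the shadow. *)
Lemma velocity_step :
  (v + s1) ^+ 2 * ip d' d' = v ^+ 2 * ip d d
  - (2 * e * (v + s1) + e ^+ 2) * ip d' d' - 2 * a * s0 * ip d' g'
  - 2 * a * (a - s0) * ip d' (g' - g)
  - ip (s0 *: g' + (a - s0) *: (g' - g)) (s0 *: g' + (a - s0) *: (g' - g)).
Proof.
have -> : v ^+ 2 * ip d d = ip (v *: d) (v *: d).
  by rewrite !(ipE hip) mulrA.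
rewrite step !(ipE hip) (ipC g' d') (ipC g d') (ipC g g') /a.
by ring.
Qed.

(** By [step], two consecutive shadows differ by [e *: d' + (s0 - s1) *: g']. *)
Lemma shadow_step :
  ip (shadow e s0 s1 (v + s1) d' g') (shadow e s0 s1 (v + s1) d' g') =
  ip (shadow e s0 s1 v d g) (shadow e s0 s1 v d g)
  - 2 * ip (e *: d' + (s0 - s1) *: g') (shadow e s0 s1 (v + s1) d' g')
  - ip (e *: d' + (s0 - s1) *: g') (e *: d' + (s0 - s1) *: g').
Proof.
rewrite /shadow step !(ipE hip) (ipC g' d') (ipC g d') (ipC g g') /a.
by ring.
Qed.

End Step.

Variables (e s0 s1 nu0 rho : R).
Hypotheses (s1_gt0 : 0 < s1) (s1s0 : s1 < s0) (s0e : s0 < e).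
Hypotheses (nu0_ge0 : 0 <= nu0) (rho_gt0 : 0 < rho).
Variables (x d g : nat -> H).
Hypothesis xS : forall n, x n.+1 = x n + d n.+1.
Hypothesis dgS : forall n,
  d n.+1 + g n.+1 = theta e s1 nu0 n *: d n + gamma e s0 s1 nu0 n *: g n.
Hypothesis xg_ge0 : forall n, 0 <= ip (x n) (g n).
Hypothesis dg_coercive : forall n,
  rho * ip (g n.+1 - g n) (g n.+1 - g n) <= ip (d n.+1) (g n.+1 - g n).

Local Notation v := (nu s1 nu0).
Local Notation a n := (e + v n.+1).

Let vS n : v n.+1 = v n + s1. Proof. by rewrite /nu -natr1; ring. Qed.
Let v_ge n : s1 * n%:R <= v n. Proof. by rewrite /nu lerDl. Qed.
Let v_ge0 n : 0 <= v n.
Proof. by apply: le_trans (v_ge n); rewrite mulr_ge0 // ltW. Qed.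
Let a_gt0 n : 0 < a n.
Proof. by have := v_ge0 n.+1; move: s1_gt0 s1s0 s0e; lra. Qed.
Let as0_gt n : v n.+1 < a n - s0.
Proof. by move: s1_gt0 s1s0 s0e; lra. Qed.

Let step n : v n *: d n = (e + (v n + s1)) *: (d n.+1 + g n.+1)
  - (e + (v n + s1) - s0) *: g n.
Proof.
rewrite dgS scalerDr !scalerA -vS.
have an := lt0r_neq0 (a_gt0 n).
have -> : (e + v n.+1) * theta e s1 nu0 n = v n.
  by rewrite /theta mulrBr (mulrC (a n) (_ / _)) divfK // vS; ring.
have -> : (e + v n.+1) * gamma e s0 s1 nu0 n = e + v n.+1 - s0.
  by rewrite /gamma mulrBr (mulrC (a n) (_ / _)) divfK // mulr1.
by rewrite addrK.
Qed.

Let E n := energy e s0 s1 (v n) (x n) (d n) (g n).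

Let dg_ge0 n : 0 <= ip (d n.+1) (g n.+1 - g n).
Proof.
by apply: le_trans (dg_coercive n); rewrite mulr_ge0 ?ip_pos // ltW.
Qed.

Let E_step n : E n.+1 <= E n
  - ((e + s1) * (s0 - s1) * ip (x n.+1) (g n.+1)
    + a n * (a n - s0) * ip (d n.+1) (g n.+1 - g n)
    + v n.+1 * ((s0 - s1) * ip (d n.+1 + g n.+1) (d n.+1 + g n.+1)
    + (e - s0) * ip (d n.+1) (d n.+1))).
Proof.
rewrite /E xS vS (energy_step (x n) (step n)) -vS -xS.
set p := ip (s0 *: _ + _) _; have p0 : 0 <= p by exact: ip_pos.
have q1 := ip_pos hip (d n.+1 + g n.+1); have q2 := ip_pos hip (d n.+1).
have q3 := ip_pos hip (g n.+1).
have k1 : 0 <= (s0 - s1) * (e + s1 - s0) / 2 * ip (g n.+1) (g n.+1).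
  by rewrite !mulr_ge0 //; move: s1_gt0 s1s0 s0e; lra.
have k2 : 0 <= e * ((s0 - s1) / 2 * ip (d n.+1 + g n.+1) (d n.+1 + g n.+1)
    + (e - s0) / 2 * ip (d n.+1) (d n.+1)).
  by rewrite mulr_ge0 ?addr_ge0 ?mulr_ge0 //; move: s1_gt0 s1s0 s0e; lra.
move: s1_gt0 s1s0 s0e; lra.
Qed.

Let E_ge n : (e + s1) / 2 * ((e - s1) / 2) * ip (x n) (x n) <= E n.
Proof. exact: energy_ge. Qed.

Let E_ge0 n : 0 <= E n.
Proof.
apply: le_trans (E_ge n); rewrite !mulr_ge0 ?ip_pos //; move: s1_gt0 s1s0 s0e; lra.
Qed.

Let sum_terms : bounded_sums (fun n =>
    (e + s1) * (s0 - s1) * ip (x n.+1) (g n.+1)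
    + a n * (a n - s0) * ip (d n.+1) (g n.+1 - g n)
    + v n.+1 * ((s0 - s1) * ip (d n.+1 + g n.+1) (d n.+1 + g n.+1)
    + (e - s0) * ip (d n.+1) (d n.+1))).
Proof. exact: bounded_sums_telescope E_step E_ge0. Qed.

Let t1_ge0 n : 0 <= (e + s1) * (s0 - s1) * ip (x n.+1) (g n.+1).
Proof. by rewrite !mulr_ge0 //; move: s1_gt0 s1s0 s0e; lra. Qed.
Let t2_ge0 n : 0 <= a n * (a n - s0) * ip (d n.+1) (g n.+1 - g n).
Proof.
rewrite !mulr_ge0 // ?ltW ?a_gt0 //.
exact: le_lt_trans (v_ge0 n.+1) (as0_gt n).
Qed.
Let t3_ge0 n : 0 <= v n.+1 * ((s0 - s1) * ip (d n.+1 + g n.+1) (d n.+1 + g n.+1)).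
Proof. by rewrite !mulr_ge0 ?ip_pos // subr_ge0 ltW. Qed.
Let t4_ge0 n : 0 <= v n.+1 * ((e - s0) * ip (d n.+1) (d n.+1)).
Proof. by rewrite !mulr_ge0 ?ip_pos // subr_ge0 ltW. Qed.

Let sum_vd : bounded_sums (fun n => v n.+1 * ip (d n.+1) (d n.+1)).
Proof.
apply: bounded_sums_le (_ : bounded_sums (fun n => (e - s0)^-1 * _)); last first.
  by apply: bounded_sumsZ sum_terms; rewrite invr_ge0 subr_ge0 ltW.
move=> n /=; rewrite ler_pdivlMl ?subr_gt0 //.
by move: (t1_ge0 n) (t2_ge0 n) (t3_ge0 n); lra.
Qed.

Let sum_vg : bounded_sums (fun n => v n.+1 * ip (g n.+1) (g n.+1)).
Proof.
apply: bounded_sums_le (_ : bounded_sums (fun n =>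
   2 * ((s0 - s1)^-1 * _) + 2 * (v n.+1 * ip (d n.+1) (d n.+1)))); last first.
  apply: bounded_sumsD; last by apply: bounded_sumsZ.
  apply: bounded_sumsZ => //.
  by apply: bounded_sumsZ sum_terms; rewrite invr_ge0 subr_ge0 ltW.
move=> n /=.
have h : v n.+1 * ip (d n.+1 + g n.+1) (d n.+1 + g n.+1) <= (s0 - s1)^-1 *
   ((e + s1) * (s0 - s1) * ip (x n.+1) (g n.+1)
    + a n * (a n - s0) * ip (d n.+1) (g n.+1 - g n)
    + v n.+1 * ((s0 - s1) * ip (d n.+1 + g n.+1) (d n.+1 + g n.+1)
    + (e - s0) * ip (d n.+1) (d n.+1))).
  rewrite ler_pdivlMl ?subr_gt0 //.
  by move: (t1_ge0 n) (t2_ge0 n) (t4_ge0 n); lra.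
apply: le_trans (_ : _ <= 2 * (v n.+1 * ip (d n.+1 + g n.+1) (d n.+1 + g n.+1))
  + 2 * (v n.+1 * ip (d n.+1) (d n.+1))) _; last by rewrite lerD2r ler_pM2l.
(* The energy dissipates [d + g] and [d]; the residual is recovered as their difference. *)
have := ip_normD_le2 hip (d n.+1 + g n.+1) (- d n.+1).
rewrite addrC addKr (ipNl hip) (ipNr hip) opprK => /(ler_wpM2l (v_ge0 n.+1)).
move: s1_gt0 s1s0 s0e; lra.
Qed.

Let v_le_a n : v n.+1 <= a n.
Proof. by rewrite lerDr; move: s1_gt0 s1s0 s0e; lra. Qed.

(** Coercivity converts the dissipated [<d, g' - g>] into [|g' - g|^2]; the factor [e / (e - s0)]
    bounds [a / (a - s0)], as [a >= e]. *)
Let adg_le n : (a n) ^+ 2 * ip (g n.+1 - g n) (g n.+1 - g n) <=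
  e / (e - s0) * rho^-1 * (a n * (a n - s0) * ip (d n.+1) (g n.+1 - g n)).
Proof.
have e0 : 0 < e - s0 by rewrite subr_gt0.
have h1 : a n <= e / (e - s0) * (a n - s0).
  rewrite mulrAC ler_pdivlMr //; move: (v_ge0 n.+1) s1_gt0 s1s0 s0e; nra.
have h2 : ip (g n.+1 - g n) (g n.+1 - g n) <=
    rho^-1 * ip (d n.+1) (g n.+1 - g n) by rewrite ler_pdivlMl.
rewrite expr2 -mulrA.
have -> : e / (e - s0) / rho * (a n * (a n - s0) * ip (d n.+1) (g n.+1 - g n)) =
    a n * (e / (e - s0) * (a n - s0) * (rho^-1 * ip (d n.+1) (g n.+1 - g n))).
  by ring.
by rewrite ler_wpM2l ?ler_pM ?ip_pos // ltW ?a_gt0.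
Qed.

Let S n := ip (d n) (d n) + ip (g n) (g n).

Let S_ge0 n : 0 <= S n.
Proof. by rewrite addr_ge0 ?ip_pos. Qed.

Let sum_S : bounded_sums (fun n => (v n + e) * S n).
Proof.
(* [e / s1 + 1] absorbs the extra [e], because [v n.+1 >= s1]. *)
apply: bounded_sums_shift; apply: bounded_sums_le
  (bounded_sumsZ (_ : 0 <= e / s1 + 1) (bounded_sumsD sum_vd sum_vg)); last first.
  by rewrite addr_ge0 // divr_ge0 //; move: s1_gt0 s1s0 s0e; lra.
move=> n; rewrite -mulrDr mulrA ler_wpM2r // mulrDl mul1r addrC lerD2r.
rewrite mulrAC ler_pdivlMr // ler_wpM2l //; first by move: s1_gt0 s1s0 s0e; lra.
by apply: le_trans (v_ge n.+1); rewrite ler_pMr // ler1n.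
Qed.

Let ve_le n : v n + e <= (s1 + nu0 + e) * n.+1%:R.
Proof.
rewrite /nu -natr1; have : 0 <= n%:R :> R by [].
by move: (n%:R) nu0_ge0 s1_gt0 s1s0 s0e => p; nra.
Qed.

Let ve_ge0 n : 0 <= v n + e.
Proof. by move: (v_ge0 n) s1_gt0 s1s0 s0e; lra. Qed.

Let v_le_ve n : v n <= v n + e.
Proof. by move: s1_gt0 s1s0 s0e; lra. Qed.

(** [v n + e] grows at most linearly, so dividing by [n + 1] costs one of the two factors and leaves
    the summable [(v n + e) * S n]. *)
Let harmonic_S (h : nat -> R) : (forall n, h n <= 2 * (v n + e) ^+ 2 * S n) ->
  bounded_sums (fun n => h n / n.+1%:R).
Proof.
move=> hS; apply: bounded_sums_le
  (bounded_sumsZ (_ : 0 <= 2 * (s1 + nu0 + e)) sum_S); last first.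
  by move: nu0_ge0 s1_gt0 s1s0 s0e; lra.
move=> n; rewrite ler_pdivrMr //; apply: le_trans (hS n) _.
have -> : 2 * (s1 + nu0 + e) * ((v n + e) * S n) * n.+1%:R =
  2 * (v n + e) * ((s1 + nu0 + e) * n.+1%:R) * S n by ring.
by rewrite ler_wpM2r // expr2 mulrA ler_wpM2l // mulr_ge0.
Qed.

Let sum_aS (K : R) : 0 <= K -> bounded_sums (fun n => K * (a n * S n.+1)).
Proof.
move=> K0; apply: bounded_sumsZ => //.
apply: bounded_sums_le (bounded_sums_unshift sum_S) => n.
by rewrite (addrC e).
Qed.

(** In [velocity_step] only the cross term in [<d', g'>] may have the wrong sign, and it is
    dominated by a summable multiple of [a * S]. So a limit exists, and [harmonic_S] forces it to be
    0. *)
Let cvg_vd : (fun n => (v n) ^+ 2 * ip (d n) (d n)) @ \oo --> (0 : R).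
Proof.
have h0 n : 0 <= (v n) ^+ 2 * ip (d n) (d n) by rewrite mulr_ge0 ?sqr_ge0 ?ip_pos.
have s00 : 0 <= s0 by move: s1_gt0 s1s0 s0e; lra.
have [||l hl] := @cvg_quasi_nonincreasing _ _ _ h0 _ (sum_aS s00).
- by move=> n; rewrite !mulr_ge0 // ltW ?a_gt0.
- move=> n; rewrite vS (velocity_step (step n)) -vS.
  have := t2_ge0 n; set t2 := a n * _ * _ => t20.
  have := ip_pos hip (s0 *: g n.+1 + (a n - s0) *: (g n.+1 - g n)).
  have : 0 <= (2 * e * v n.+1 + e ^+ 2) * ip (d n.+1) (d n.+1).
    rewrite mulr_ge0 ?ip_pos // addr_ge0 ?sqr_ge0 // mulr_ge0 //.
    by move: s1_gt0 s1s0 s0e; lra.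
  have : a n * s0 * (- 2 * ip (d n.+1) (g n.+1)) <= a n * s0 * S n.+1.
    rewrite ler_wpM2l ?mulr_ge0 ?(ltW (a_gt0 n)) //.
    have := ip_le_half hip (- d n.+1) (g n.+1).
    by rewrite !(ipNl hip) (ipNr hip) opprK /S; lra.
  have -> : 2 * a n * (a n - s0) * ip (d n.+1) (g n.+1 - g n) = 2 * t2.
    by rewrite /t2; ring.
  by clearbody t2; lra.
apply: cvg0_of_harmonic_bounded_sums hl _ => //.
apply: harmonic_S => n.
have : 0 <= (v n) ^+ 2 * ip (g n) (g n) by rewrite mulr_ge0 ?sqr_ge0 ?ip_pos.
have : v n ^+ 2 * S n <= (v n + e) ^+ 2 * S n.
  by rewrite ler_wpM2r // lerXn2r ?nnegrE ?ve_ge0 ?v_le_ve.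
by have := h0 n; rewrite /S; lra.
Qed.

Let sh n := shadow e s0 s1 (v n) (d n) (g n).

Let cvg_sh : (fun n => ip (sh n) (sh n)) @ \oo --> (0 : R).
Proof.
have h0 n : 0 <= ip (sh n) (sh n) by exact: ip_pos.
(* The first two terms bound [|p|^2] by multiples of [S]; the 3 collects [|q|^2 <= 2 S] and
   [|g|^2 <= S]. *)
have K0 : 0 <= 2 * e ^+ 2 + 2 * (s0 - s1) ^+ 2 + 3.
  by rewrite !addr_ge0 // mulr_ge0 // sqr_ge0.
have [||l hl] := @cvg_quasi_nonincreasing _ _ _ h0 _ (sum_aS K0).
- by move=> n; rewrite !mulr_ge0 // ltW ?a_gt0.
- move=> n; rewrite /sh vS (shadow_step (step n)) -vS.
  set p := e *: _ + _ *: _; have p0 := ip_pos hip p.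
  pose q := d n.+1 + g n.+1.
  have -> : shadow e s0 s1 (v n.+1) (d n.+1) (g n.+1) =
      v n.+1 *: q + (e + s1 - s0) *: g n.+1.
    by rewrite /shadow /q scalerDr (scalerDl (g n.+1) (v n.+1)) addrA.
  have pp : ip p p <= 2 * e ^+ 2 * ip (d n.+1) (d n.+1) +
      2 * (s0 - s1) ^+ 2 * ip (g n.+1) (g n.+1).
    apply: le_trans (ip_normD_le2 hip _ _) _.
    by rewrite !(ipZl hip) !(ipZr hip); lra.
  have qq : ip q q <= 2 * S n.+1.
    by apply: le_trans (ip_normD_le2 hip _ _) _; rewrite /S; lra.
  have pq : - 2 * ip p q <= ip p p + ip q q.
    have := ip_le_half hip (- p) q.
    by rewrite !(ipNl hip) (ipNr hip) opprK; lra.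
  have pg : - 2 * ip p (g n.+1) <= ip p p + ip (g n.+1) (g n.+1).
    have := ip_le_half hip (- p) (g n.+1).
    by rewrite !(ipNl hip) (ipNr hip) opprK; lra.
  have d0 := ip_pos hip (d n.+1); have g0 := ip_pos hip (g n.+1).
  have q0 := ip_pos hip q.
  rewrite (ipDr hip p) !(ipZr hip _ p).
  have c0 : 0 <= e + s1 - s0 by move: s1_gt0 s1s0 s0e; lra.
  have r1 : v n.+1 * (- 2 * ip p q) <= v n.+1 * (ip p p + ip q q).
    by rewrite ler_wpM2l.
  have r2 : (e + s1 - s0) * (- 2 * ip p (g n.+1)) <=
     (e + s1 - s0) * (ip p p + ip (g n.+1) (g n.+1)) by rewrite ler_wpM2l.
  have r3 : (v n.+1 + (e + s1 - s0)) * ip p p <= a n * ip p p.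
    by rewrite ler_wpM2r // addrC lerD2r; move: s1_gt0 s1s0 s0e; lra.
  have r4 : v n.+1 * ip q q <= a n * ip q q by rewrite ler_wpM2r.
  have r5 : (e + s1 - s0) * ip (g n.+1) (g n.+1) <= a n * ip (g n.+1) (g n.+1).
    by rewrite ler_wpM2r //; move: (v_ge0 n.+1) s1_gt0 s1s0 s0e; lra.
  have r6 : a n * (ip p p + ip q q + ip (g n.+1) (g n.+1)) <=
      a n * ((2 * e ^+ 2 + 2 * (s0 - s1) ^+ 2 + 3) * S n.+1).
    rewrite ler_wpM2l ?(ltW (a_gt0 n)) //.
    have := sqr_ge0 e; have := sqr_ge0 (s0 - s1).
    move: pp qq; rewrite /S; move: (e ^+ 2) ((s0 - s1) ^+ 2) => e2 b2; nra.
  move: s1_gt0 s1s0 s0e; lra.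
apply: cvg0_of_harmonic_bounded_sums hl _ => //.
apply: harmonic_S => n.
apply: le_trans (ip_normD_le2 hip _ _) _; rewrite !(ipE hip).
have d0 := ip_pos hip (d n); have g0 := ip_pos hip (g n).
have r1 : v n * (v n * ip (d n) (d n)) <= (v n + e) ^+ 2 * ip (d n) (d n).
  rewrite mulrA ler_wpM2r // -expr2 lerXn2r ?nnegrE //; move: (v_ge0 n) s1_gt0 s1s0 s0e; lra.
have r2 : (v n + (e + s1 - s0)) * ((v n + (e + s1 - s0)) * ip (g n) (g n)) <=
   (v n + e) ^+ 2 * ip (g n) (g n).
  rewrite mulrA ler_wpM2r // -expr2 lerXn2r ?nnegrE //; move: (v_ge0 n) s1_gt0 s1s0 s0e; lra.
by rewrite /S; lra.
Qed.

(** For [n >= 1], [n + 1 <= 2 n <= 2 v n / s1]; positivity of [s1] is what turns decay in [v n] into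
    decay in [n]. *)
Let n2_le (h k : nat -> R) : (forall n, 0 <= h n) -> k @ \oo --> (0 : R) ->
  (forall n, (v n) ^+ 2 * h n <= k n) ->
  (fun n => n.+1%:R ^+ 2 * h n) @ \oo --> (0 : R).
Proof.
move=> h0 hk hle.
have : (fun n => (4 * s1^-1 ^+ 2 * k n)) @ \oo --> 4 * s1^-1 ^+ 2 * (0 : R).
  exact: cvgMr.
rewrite mulr0; apply: squeeze_cvgr (cvg_cst 0); exists 1%N => // n /= n1.
rewrite mulr_ge0 ?sqr_ge0 //=.
apply: le_trans (_ : 4 * s1^-1 ^+ 2 * ((v n) ^+ 2 * h n) <= _); last first.
  by rewrite ler_wpM2l // mulr_ge0 // sqr_ge0.
rewrite mulrA ler_wpM2r // -mulrA -exprMn.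
have -> : 4 = 2 ^+ 2 :> R by rewrite -natrX.
rewrite -exprMn lerXn2r ?nnegrE ?mulr_ge0 ?invr_ge0 ?(ltW s1_gt0) //.
apply: le_trans (_ : 2 * n%:R <= _).
  by rewrite -natrM ler_nat mul2n -addnn -addn1 leq_add2l.
by rewrite ler_pM2l // ler_pdivlMl.
Qed.

Lemma inertial_cvg_velocity :
  (fun n => n.+1%:R ^+ 2 * ip (d n) (d n)) @ \oo --> (0 : R).
Proof. by apply: n2_le cvg_vd _ => // n; rewrite ip_pos. Qed.

Lemma inertial_cvg_residual :
  (fun n => n.+1%:R ^+ 2 * ip (g n) (g n)) @ \oo --> (0 : R).
Proof.
have hk : (fun n => 2 * ip (sh n) (sh n) + 2 * (v n ^+ 2 * ip (d n) (d n))) @ \oo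
    --> 2 * 0 + 2 * (0 : R) by apply: cvgD; exact: cvgMr.
rewrite mulr0 addr0 in hk; apply: n2_le hk _ => n; first by rewrite ip_pos.
(* Removing the velocity from the shadow isolates [g n], with a coefficient at least [v n]. *)
have := ip_normD_le2 hip (sh n) (- (v n *: d n)).
have -> : sh n - v n *: d n = (v n + (e + s1 - s0)) *: g n.
  by rewrite /sh /shadow addrAC subrr add0r.
rewrite !(ipZl hip, ipZr hip, ipNl hip, ipNr hip) opprK !mulrA -!expr2.
apply: le_trans; rewrite ler_wpM2r ?ip_pos // lerXn2r ?nnegrE //.
all: move: (v_ge0 n) s1_gt0 s1s0 s0e; lra.
Qed.

(** Multiplied by [a], the recursion writes the acceleration as fixed multiples of [d] and [g] plus
    [a *: (g - g')], and the squared norms of all three are summable. *)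
Lemma inertial_sum_acceleration :
  bounded_sums (fun n => n.+1%:R ^+ 2 * ip (d n.+1 - d n) (d n.+1 - d n)).
Proof.
have e0 : 0 < e - s0 by rewrite subr_gt0.
have sumS : bounded_sums S.
  apply: bounded_sums_le (bounded_sumsZ (_ : 0 <= e^-1) sum_S) => [n|].
    rewrite ler_pdivlMl; last by move: s1_gt0 s1s0 s0e; lra.
    by rewrite ler_wpM2r // lerDr.
  by rewrite invr_ge0; move: s1_gt0 s1s0 s0e; lra.
have sum_adg : bounded_sums (fun n => (a n) ^+ 2 * ip (g n.+1 - g n) (g n.+1 - g n)).
  apply: bounded_sums_le adg_le _; apply: bounded_sumsZ.
    by rewrite !mulr_ge0 ?invr_ge0 //; move: rho_gt0 s1_gt0 s1s0 s0e; lra.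
  by apply: bounded_sums_le sum_terms => n; move: (t1_ge0 n) (t3_ge0 n) (t4_ge0 n); lra.
have K0 : 0 <= 4 * ((e + s1) ^+ 2 + s0 ^+ 2).
  by rewrite mulr_ge0 // addr_ge0 ?sqr_ge0.
have i0 : 0 <= s1^-1 ^+ 2 by rewrite sqr_ge0.
have t0 : 0 <= 2 :> R by [].
apply: bounded_sums_le (bounded_sumsZ i0
  (bounded_sumsD (bounded_sumsZ K0 sumS) (bounded_sumsZ t0 sum_adg))) => n.
have an : a n != 0 by rewrite gt_eqF.
set D := d n.+1 - d n; set dg := g n.+1 - g n.
have -> : n.+1%:R = s1^-1 * (s1 * n.+1%:R) :> R by rewrite mulKf // gt_eqF.
rewrite exprMn -mulrA ler_wpM2l //.
apply: le_trans (_ : (a n) ^+ 2 * ip D D <= _).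
  rewrite ler_wpM2r ?ip_pos // lerXn2r ?nnegrE ?mulr_ge0 ?(ltW s1_gt0) ?(ltW (a_gt0 n)) //.
  exact: le_trans (v_ge n.+1) (v_le_a n).
have -> : (a n) ^+ 2 * ip D D = ip (a n *: D) (a n *: D).
  by rewrite (ipZl hip) (ipZr hip) mulrA.
have -> : a n *: D = - ((e + s1) *: d n + s0 *: g n) - a n *: dg.
  have -> : e + s1 = a n - v n by rewrite vS; ring.
  have h : a n *: d n.+1 = v n *: d n + (a n - s0) *: g n - a n *: g n.+1.
    by rewrite step -vS subrK scalerDr addrK.
  rewrite /D /dg scalerBr h !scalerBl scalerBr !opprD !opprK.
  by rewrite [LHS](AC ((1*2)*1*1) (5*1*3*(4*2))).
apply: le_trans (ip_normD_le2 hip _ _) _.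
rewrite !(ipNl hip) !(ipNr hip) !opprK (ipZl hip _ dg) (ipZr hip _ _ dg).
have := ip_normD_le2 hip ((e + s1) *: d n) (s0 *: g n).
rewrite !(ipZl hip, ipZr hip) /S.
have : 0 <= (e + s1) ^+ 2 * ip (g n) (g n) by rewrite mulr_ge0 ?sqr_ge0 ?ip_pos.
have : 0 <= s0 ^+ 2 * ip (d n) (d n) by rewrite mulr_ge0 ?sqr_ge0 ?ip_pos.
by rewrite !expr2 !mulrA; nra.
Qed.

Lemma inertial_position_bounded : exists B, forall n, ip (x n) (x n) <= B.
Proof.
have c0 : 0 < (e + s1) / 2 * ((e - s1) / 2).
  by rewrite mulr_gt0 //; move: s1_gt0 s1s0 s0e; lra.
exists (((e + s1) / 2 * ((e - s1) / 2))^-1 * E 0%N) => n.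
rewrite ler_pdivlMl //; apply: le_trans (E_ge n) _.
elim: n => // n; apply: le_trans; apply: le_trans (E_step n) _.
by move: (t1_ge0 n) (t2_ge0 n) (t3_ge0 n) (t4_ge0 n); lra.
Qed.

(** The energy converges, and every part of it except the multiple of [|x|^2] tends to 0; the cross
    term does so because [x] is bounded and the shadow vanishes. *)
Lemma inertial_cvg_position : exists l : R, (fun n => ip (x n) (x n)) @ \oo --> l.
Proof.
have lam0 : 0 < (e + s1) / 2 by move: s1_gt0 s1s0 s0e; lra.
have e0 : 0 < e by move: s1_gt0 s1s0 s0e; lra.
have b0 : bounded_sums (fun=> 0 : R) by exists 0 => N; rewrite big1.
have [||l hl] := @cvg_quasi_nonincreasing _ E _ E_ge0 _ b0; first by [].
  move=> n; rewrite addr0; apply: le_trans (E_step n) _.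
  by move: (t1_ge0 n) (t2_ge0 n) (t3_ge0 n) (t4_ge0 n); lra.
have xsh : (fun n => ip (x n) (sh n)) @ \oo --> (0 : R).
  have [B hB] := inertial_position_bounded.
  have B0 : 0 <= B := le_trans (ip_pos hip _) (hB 0%N).
  apply/cvgrPdist_le => eps eps0.
  have d0 : 0 < eps ^+ 2 / (B + 1) by rewrite divr_gt0 ?exprn_gt0 //; lra.
  have [N _ hN] := (cvgrPdist_le _ _).1 cvg_sh _ d0.
  exists N => // n /hN /=; rewrite !sub0r !normrN ger0_norm ?ip_pos // => h.
  rewrite -ler_sqr ?nnegrE ?(ltW eps0) // real_normK ?num_real //.
  apply: le_trans (ip_cauchy_schwarz hip _ _) _.
  apply: le_trans (_ : (B + 1) * (eps ^+ 2 / (B + 1)) <= _).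
    by rewrite ler_pM ?ip_pos //; have := hB n; lra.
  by rewrite mulrC divfK //; lra.
exists (e^-1 * (((e + s1) / 2)^-1 * l - 2 * 0 -
  ((e + s1) / 2)^-1 * (2^-1 * 0 + 2^-1 * 0))).
have -> : (fun n => ip (x n) (x n)) = (fun n => e^-1 * (((e + s1) / 2)^-1 * E n
  - 2 * ip (x n) (sh n) - ((e + s1) / 2)^-1 * (2^-1 * (v n ^+ 2 * ip (d n) (d n))
  + 2^-1 * ip (sh n) (sh n)))).
  apply/funext => n; rewrite /E /energy -/(sh n).
  by field; rewrite !gt_eqF //; move: s1_gt0 s1s0 s0e; lra.
apply: cvgMr; apply: cvgB; first by apply: cvgB; exact: cvgMr.
by apply: cvgMr; apply: cvgD; exact: cvgMr.
Qed.

Let sum_n (h : nat -> R) : (forall n, 0 <= h n) -> (forall n, h n <= S n) ->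
  bounded_sums (fun n => n.+1%:R * h n).
Proof.
move=> h0 hS; have i0 : 0 <= s1^-1 by rewrite invr_ge0 ltW.
apply: bounded_sums_le (bounded_sumsZ i0 sum_S) => n.
rewrite mulrA ler_pM // ler_pdivlMl // -natr1 mulrDr mulr1 lerD //.
by move: s1_gt0 s1s0 s0e; lra.
Qed.

Lemma inertial_sum_velocity : bounded_sums (fun n => n.+1%:R * ip (d n) (d n)).
Proof. by apply: sum_n => n; rewrite ?lerDl ip_pos. Qed.

Lemma inertial_sum_residual : bounded_sums (fun n => n.+1%:R * ip (g n) (g n)).
Proof. by apply: sum_n => n; rewrite ?lerDr ip_pos. Qed.

End InertialDynamics.

(** * Hilbert spaces: completeness, gradients, the convex gradient inequality *)

Section HilbertSpace.
Variables (R : realType) (X : hilbertType R).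
Implicit Types (x y u v : X).

Lemma hdotC x y : '[x, y] = '[y, x].
Proof. by rewrite (hermC (@hdot R X)) expr0 mul1r. Qed.

Lemma hdot_inner_product : inner_product (fun x y : X => '[x, y]).
Proof.
split=> [x y|x y z|a x y|x|x].
- exact: hdotC.
- exact: linearDl.
- by rewrite linearZl_LR.
- by rewrite hdotE sqr_ge0.
- by move/eqP; rewrite hdotE sqrf_eq0 normr_eq0 => /eqP.
Qed.

Let hip := hdot_inner_product.

Lemma hdot_complete : ip_complete (fun x y : X => '[x, y]).
Proof.
move=> u hu.
have uc : cvgn u.
  apply: cauchy_cvg; apply: cauchy_exP => eps e0.
  have [|N hN] := hu ((eps / 2) ^+ 2); first by rewrite exprn_gt0 // divr_gt0.
  exists (u N), N => // n /= Nn; rewrite -ball_normE /=.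
  have := hN N n (leqnn N) Nn; rewrite hdotE ler_sqr ?nnegrE ?divr_ge0 ?(ltW e0) //.
  by move=> /le_lt_trans; apply; lra.
exists (limn u) => eps e0.
have se : 0 < Num.sqrt eps by rewrite sqrtr_gt0.
have [N _ hN] := (cvgrPdist_le _ _).1 uc _ se.
exists N => n /hN /= h; rewrite hdotE distrC.
by rewrite -(sqr_sqrtr (ltW e0)) ler_sqr ?nnegrE ?(ltW se).
Qed.

Lemma hdot_sqrt x : Num.sqrt '[x, x] = `|x|.
Proof. by rewrite hdotE sqrtr_sqr normr_id. Qed.

Lemma hdot_le_norm x y : '[x, y] <= `|x| * `|y|.
Proof. by have := ip_le_sqrt hip x y; rewrite !hdot_sqrt. Qed.

Lemma hilbert_riesz (f : X -> R) (C : R) :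
  (forall x y, f (x + y) = f x + f y) -> (forall a x, f (a *: x) = a * f x) ->
  (forall x, f x <= C * `|x|) -> exists v, forall x, f x = '[v, x].
Proof.
move=> fD fZ fC.
have [|v hv] := riesz_representation hip hdot_complete fD fZ (C := C).
  by move=> x; rewrite hdot_sqrt.
by exists v => x; rewrite hv hdotC.
Qed.

(** Riesz representation of the differential makes the set behind [grad] nonempty, so [get] returns
    a member. *)
Lemma gradE (f : X -> R) x v : differentiable (f : X -> R^o) x ->
  'd (f : X -> R^o) x v = '[grad f x, v].
Proof.
move=> df.
have /continuous_linear_bounded/linear_boundedP : {for 0, continuous 'd (f : X -> R^o) x}.
  exact: diff_continuous.
move=> /pinfty_ex_gt0[C _ hC].
have [|||g hg] := @hilbert_riesz ('d (f : X -> R^o) x) C.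
- exact: linearD.
- by move=> a y; rewrite linearZ.
- by move=> y; apply: le_trans (ler_norm _) (hC y).
have := @getPex _ [set g : X | forall v, 'd (f : X -> R^o) x v = '[g, v]].
by apply; exists g.
Qed.

(** By convexity the difference quotients towards [y] with step in []0, 1[] are at most [f y - f x];
    the right limit at 0 is the gradient term. *)
Lemma convex_gradient_ineq (f : X -> R) :
  convex_function (E := X) setT f ->
  (forall u, differentiable (f : X -> R^o) u) ->
  forall x y, f x + '[grad f x, y - x] <= f y.
Proof.
move=> cf df x y.
suff : '[grad f x, y - x] <= f y - f x by lra.
rewrite -gradE // -deriveE //.
have dv : derivable (f : X -> R^o) x (y - x) by exact: diff_derivable.
apply: (cvgr_to_le (cvg_dnbhs_at_right dv)).
near=> h.
have h0 : 0 < h by near: h; exact: nbhs_right_gt.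
have h1 : h < 1 by near: h; exact: nbhs_right_lt.
rewrite /= /GRing.scale /= mulrC ler_pdivrMr //.
pose t : {i01 R} := Itv01 (ltW h0) (ltW h1).
have := cf t y x (in_setT _) (in_setT _).
have -> : conv t (y : convex_lmodType X) x = h *: (y - x) + x.
  change (h *: y + (1 - h) *: x = h *: (y - x) + x).
  by rewrite scalerBl scale1r scalerBr addrA addrAC.
rewrite convRE => fh.
have {}fh : f (h *: (y - x) + x) <= h * f y + (1 - h) * f x := fh.
lra.
Unshelve. all: by end_near.
Qed.

End HilbertSpace.

(** * The descent lemma and the Baillon-Haddad theorem *)

Section Cocoercivity.
Variables (R : realType) (X : hilbertType R) (f : X -> R) (F : X -> X) (L : R).
Hypothesis L_gt0 : 0 < L.
Hypothesis FL : L.-lipschitz F.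
Hypothesis fF : forall x y, f x + '[F x, y - x] <= f y.

Let hip := @hdot_inner_product R X.

Let F_lip x y : `|F x - F y| <= L * `|x - y|.
Proof. exact: (FL (x := (x, y))). Qed.

(* Bisecting the segment improves a constant c in the descent inequality to
   1/4 + c/2, whose fixed point is the optimal 1/2. *)
Let descent_approx k x v : f (x + v) - f x - '[F x, v] <=
  (2^-1 + 2^-1 ^+ k.+1) * L * '[v, v].
Proof.
have lip u w : '[F (u + w) - F u, w] <= L * '[w, w].
  apply: le_trans (hdot_le_norm _ _) _; rewrite hdotE expr2 mulrA ler_wpM2r //.
  by have := F_lip (u + w) u; rewrite addrAC subrr add0r.
elim: k x v => [|k IH] x v.
  have := fF (x + v) x; have := lip x v.
  rewrite opprD addrA subrr add0r !(ipE hip) expr1; move: L_gt0; lra.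
pose h := 2^-1 *: v.
have vE : v = h + h by rewrite /h -scalerDl (_ : 2^-1 + 2^-1 = 1) ?scale1r //; lra.
have := IH x h; have := IH (x + h) h; have := lip x h.
rewrite vE addrA; move: h {vE} => h.
rewrite (exprS _ k.+1); move: (2^-1 ^+ k.+1) => q.
rewrite !(ipE hip).
by lra.
Qed.

Lemma descent_lemma x v : f (x + v) - f x - '[F x, v] <= L / 2 * '[v, v].
Proof.
apply: (@ler_of_small _ _ _ (L * '[v, v])) => t t0 _.
have [N hN] := inv_succ_small t0.
apply: le_trans (descent_approx N x v) _.
have : (2^-1 ^+ N.+1 : R) <= t.
  apply: le_trans (hN N (leqnn N)); rewrite exprVn lef_pV2 ?posrE ?exprn_gt0 //.
  by rewrite -natrX ler_nat; exact/ltnW/ltn_expl.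
have : 0 <= L * '[v, v] by rewrite mulr_ge0 ?(ltW L_gt0) ?hdotE ?sqr_ge0.
move: (2^-1 ^+ _) => q; nra.
Qed.

(** [f - <F a, _>] is minimal at [a], and a gradient step of length [1/L] from [b] lowers it by
    [|F b - F a|^2 / (2 L)]: this is [key]. Adding [key] with [a] and [b] exchanged gives
    cocoercivity. *)
Lemma baillon_haddad x y : '[F x - F y, F x - F y] <= L * '[F x - F y, x - y].
Proof.
have key a b : f a + '[F a, b - a] + (2 * L)^-1 * '[F b - F a, F b - F a] <= f b.
  pose g := F b - F a.
  have h1 := fF a (b - L^-1 *: g).
  have h2 := descent_lemma b (- (L^-1 *: g)).
  have e1 : L / 2 * '[- (L^-1 *: g), - (L^-1 *: g)] = (2 * L)^-1 * '[g, g].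
    by rewrite !(ipE hip); field; rewrite (gt_eqF L_gt0).
  have e2 : L^-1 * '[F b, g] - L^-1 * '[F a, g] = L^-1 * '[g, g].
    by rewrite /g !(ipE hip); ring.
  have e3 : (2 * L)^-1 * '[g, g] = L^-1 * '[g, g] / 2.
    by field; rewrite (gt_eqF L_gt0).
  move: h1 h2; rewrite e1 -/g e3 addrAC.
  rewrite (ipDr hip _ (b - a)) !(ipNr hip _ (L^-1 *: g)) !(ipZr hip).
  by move: e2; lra.
have := key x y; have := key y x.
have -> : '[F y - F x, F y - F x] = '[F x - F y, F x - F y].
  by rewrite -opprB (ipNl hip) (ipNr hip) opprK.
move=> h1 h2.
rewrite mulrC -ler_pdivrMr // mulrC.
have -> : L^-1 * '[F x - F y, F x - F y] =
    (2 * L)^-1 * '[F x - F y, F x - F y] + (2 * L)^-1 * '[F x - F y, F x - F y].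
  by field; rewrite (gt_eqF L_gt0).
move: h1 h2; move: (_ * '[F x - F y, F x - F y]) => q.
rewrite !(ipE hip) => h1 h2; lra.
Qed.

End Cocoercivity.

(** * Adjoint and operator norm *)

Section BoundedOperator.
Variables (R : realType) (X Y : hilbertType R) (K : {linear X -> Y}).
Hypothesis K_bounded : bounded_near K (nbhs (0 : X)).

Let K_bound : exists C, 0 < C /\ forall x, `|K x| <= C * `|x|.
Proof.
by move: K_bounded => /linear_boundedP /pinfty_ex_gt0[C C0 hC]; exists C.
Qed.

Lemma adjointE x y : '[K x, y] = '[x, adjoint K y].
Proof.
have [C [C0 hC]] := K_bound.
have [|||z hz] := @hilbert_riesz _ _ (fun x => '[K x, y]) (C * `|y|).
- by move=> a b; rewrite linearD (ipDl (hdot_inner_product Y)).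
- by move=> a b; rewrite linearZ (ipZl (hdot_inner_product Y)).
- move=> u; apply: le_trans (hdot_le_norm _ _) _.
  by rewrite mulrAC ler_wpM2r.
have := @getPex _ [set z : X | forall x, '[K x, y] = '[x, z]].
by move=> /(_ _ x); apply; exists z => u; rewrite hz hdotC.
Qed.

Lemma opnorm_ge0 : 0 <= opnorm K.
Proof.
have [C [C0 hC]] := K_bound.
apply: ub_le_sup.
  exists C => _ [x /= x1 <-]; apply: le_trans (hC x) _.
  by rewrite ler_piMr // ltW.
by exists 0; rewrite /= ?linear0 normr0.
Qed.

Lemma le_opnorm x : `|K x| <= opnorm K * `|x|.
Proof.
have [C [C0 hC]] := K_bound.
have [->|x0] := eqVneq x 0; first by rewrite linear0 !normr0 mulr0.
have nx : 0 < `|x| by rewrite normr_gt0.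
have : `|K (`|x|^-1 *: x)| <= opnorm K.
  apply: ub_le_sup.
    exists C => _ [y /= y1 <-]; apply: le_trans (hC y) _.
    by rewrite ler_piMr // ltW.
  exists (`|x|^-1 *: x) => //=.
  by rewrite normrZ normfV normr_id mulVf ?gt_eqF.
by rewrite linearZ normrZ normfV normr_id mulrC ler_pdivrMr.
Qed.

End BoundedOperator.

(** * Existence and optimality condition of proximal points *)

Section Prox.
Variables (R : realType) (X : hilbertType R) (g : X -> \bar R) (t : R).
Hypotheses (g_proper : proper_efun g) (g_convex : convex_efun g).
Hypotheses (g_lsc : lower_semicontinuous g) (t_gt0 : 0 < t).

Let hip := @hdot_inner_product R X.

Let real_point : exists x0 a0, g x0 = a0%:E.
Proof.
have [h1 [x0 h2]] := g_proper; exists x0, (fine (g x0)).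
by rewrite fineK // fin_real // h1.
Qed.

Let g_real u (c r : R) : (g u + c%:E <= r%:E)%E ->
  exists a, g u = a%:E /\ a + c <= r.
Proof.
have [/(_ u) h1 _] := g_proper; case: (g u) h1 => [a _||] //=.
by rewrite -EFinD lee_fin => h; exists a.
Qed.

Let g_convexR (s : R) u v a b : 0 < s -> s < 1 -> g u = a%:E -> g v = b%:E ->
  exists c, g (s *: u + (1 - s) *: v) = c%:E /\ c <= s * a + (1 - s) * b.
Proof.
move=> s0 s1 gu gv.
have := g_convex u v (introT andP (conj s0 s1)).
rewrite gu gv -!EFinM -EFinD => h.
have [|c [gc cle]] := @g_real (s *: u + (1 - s) *: v) 0 (s * a + (1 - s) * b).
  by rewrite adde0.
by exists c; rewrite addr0 in cle.
Qed.

(** Near [x0] the bound is lower semicontinuity. A far point [u] is pulled along the segment to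
    distance [r] from [x0], and convexity carries the bound back to [u]; no separation theorem is
    involved. *)
Let affine_minorant x0 a0 : g x0 = a0%:E ->
  exists2 r : R, 0 < r & forall u b, g u = b%:E -> a0 - 1 - r^-1 * `|u - x0| <= b.
Proof.
move=> g0; have [|V Vx0 gV] := g_lsc (x := x0) (a := a0 - 1).
  by rewrite g0 lte_fin; lra.
have [e /= e0 eV] := (nbhs_ballP _ _).1 Vx0.
have [r r0 re] : exists2 r : R, 0 < r & r < e by exists (e / 2); lra.
exists r => // u b gu.
have [near|far] := ltP `|u - x0| e.
  have : ((a0 - 1)%:E < g u)%E by apply/gV/eV; rewrite -ball_normE /= distrC.
  rewrite gu lte_fin.
  have : 0 <= r^-1 * `|u - x0| by rewrite mulr_ge0 // invr_ge0 ltW.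
  lra.
have n0 : 0 < `|u - x0| by apply: lt_le_trans far.
pose s := r / `|u - x0|.
have s0 : 0 < s by rewrite divr_gt0.
have s1 : s < 1 by rewrite ltr_pdivrMr // mul1r; lra.
have [c [gc cle]] := g_convexR s0 s1 gu g0.
have : ((a0 - 1)%:E < g (s *: u + (1 - s) *: x0)%R)%E.
  apply/gV/eV; rewrite -ball_normE /= distrC scalerBl scale1r.
  by rewrite addrA addrAC addrK -scalerBr normrZ gtr0_norm // divfK // gt_eqF.
rewrite gc lte_fin => h.
have sE : r^-1 * `|u - x0| = s^-1 by rewrite /s invf_div mulrC.
have ss : s * s^-1 = 1 by rewrite mulfV // gt_eqF.
by rewrite sE -(ler_pM2l s0) !mulrBr ss; lra.
Qed.

Let obj x u := (g u + ((2 * t)^-1 * `|x - u| ^+ 2)%:E)%E.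

Let prox_exists x : exists p, forall v, (obj x p <= obj x v)%E.
Proof.
pose c := (2 * t)^-1; have c0 : 0 < c by rewrite invr_gt0 mulr_gt0.
have [x0 [a0 g0]] := real_point.
have [r r0 gmin] := affine_minorant g0.
(* The last term of the lower bound is the minimum of [c m^2 - m / r] over [m = |x - u|]; [c / 4] is
   the parallelogram modulus of the quadratic term. *)
have [| | | | |p [s [ps pmin]]] := @epigraph_minimizer _ _ _ (@hdot_complete R X)
    (fun u (s : R) => (obj x u <= s%:E)%E)
    (a0 - 1 - r^-1 * `|x - x0| - (4 * c)^-1 * r^-1 ^+ 2) (c / 4).
- by rewrite divr_gt0.
- by exists x0, (a0 + c * `|x - x0| ^+ 2); rewrite /obj g0 -EFinD lexx.
- move=> u s /g_real[b [gu]]; rewrite -/c => bs.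
  have := gmin u b gu.
  have : r^-1 * `|u - x0| <= r^-1 * (`|x - u| + `|x - x0|).
    rewrite ler_wpM2l ?invr_ge0 ?(ltW r0) // (distrC x u).
    by rewrite (le_trans _ (ler_normD _ _)) // subrKA.
  have c4 : (4 * c)^-1 * (4 * c) = 1 by rewrite mulVf // gt_eqF // mulr_gt0.
  have : 0 <= (4 * c)^-1 * (r^-1 - 2 * c * `|x - u|) ^+ 2.
    by rewrite mulr_ge0 ?sqr_ge0 // invr_ge0 mulr_ge0 // ltW.
  have -> : (4 * c)^-1 * (r^-1 - 2 * c * `|x - u|) ^+ 2 = (4 * c)^-1 * r^-1 ^+ 2
      - r^-1 * `|x - u| + c * `|x - u| ^+ 2.
    by field; rewrite !gt_eqF.
  by lra.
- move=> u v s s' /g_real[a [gu]] + /g_real[b [gv]]; rewrite -/c => h1 h2.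
  have h0 : 2^-1 < 1 :> R by lra.
  have [|d [gd dle]] := g_convexR _ h0 gu gv; first lra.
  have e : 1 - 2^-1 = 2^-1 :> R by lra.
  move: gd; rewrite e -scalerDr /obj => ->; rewrite -EFinD lee_fin -/c.
  move: dle h1 h2; rewrite e -!hdotE !(ipE hip) (hdotC v u).
  rewrite (hdotC u x) (hdotC v x); nra.
- move=> l s h; rewrite leNgt; apply/negP => lt_s.
  have [D D0 hD] : exists2 D, 0 < D & ((s - c * `|x - l| ^+ 2 + D)%:E < g l)%E.
    have [/(_ l) gl _] := g_proper; move: lt_s gl; rewrite /obj -/c.
    case: (g l) => [b| |] //=.
      rewrite -EFinD lte_fin => lt_s _.
      exists ((b + c * `|x - l| ^+ 2 - s) / 2); first by rewrite divr_gt0 // subr_gt0.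
      by rewrite lte_fin; lra.
    by move=> _ _; exists 1 => //; rewrite ltry.
  have [V /nbhs_ballP[e /= e0 eV] gV] := g_lsc hD.
  pose B := 2 * c * `|x - l| + 1.
  have B0 : 0 < B by rewrite /B ltr_wpDl // !mulr_ge0 // ltW.
  (* An approximant within [q] of [l] stays in the ball where [g] exceeds its bound by [D], while
     the tolerance [q^2] and the variation of the quadratic amount to at most [q B <= D / 2]. *)
  pose q := Num.min (1 / 2) (Num.min (e / 2) (D / (2 * B))).
  have q0 : 0 < q by rewrite !lt_min !divr_gt0 // mulr_gt0.
  have q1 : q <= 1 / 2 by rewrite ge_min lexx.
  have qe : q <= e / 2 by rewrite !ge_min lexx orbT.
  have qD : q * (2 * B) <= D.
    by rewrite -ler_pdivlMr ?mulr_gt0 // !ge_min lexx !orbT.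
  have [|u [s' [h1 h2 /g_real[b [gu]]]]] := h (q ^+ 2); first by rewrite exprn_gt0.
  rewrite -/c => h3.
  have nul : `|u - l| <= q.
    by rewrite -ler_sqr ?nnegrE ?(ltW q0) // -hdotE.
  have : ((s - c * `|x - l| ^+ 2 + D)%:E < g u)%E.
    apply/gV/eV; rewrite -ball_normE /= distrC; apply: le_lt_trans nul _; lra.
  rewrite gu lte_fin => h4.
  have h5 : `|x - l| ^+ 2 - `|x - u| ^+ 2 <= 2 * (`|x - l| * q).
    have : `|x - l| * `|u - l| <= `|x - l| * q by rewrite ler_wpM2l.
    have := hdot_le_norm (x - l) (u - l).
    have := ip_pos hip (u - l).
    rewrite -!hdotE !(ipE hip) (hdotC l x) (hdotC u x) (hdotC l u); lra.
  have h6 : c * (`|x - l| ^+ 2 - `|x - u| ^+ 2) <= c * (2 * (`|x - l| * q)).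
    by rewrite ler_wpM2l // ltW.
  by move: qD; rewrite /B; nra.
exists p => v; apply: le_trans ps _.
rewrite leNgt; apply/negP => lts.
have [b [gv bs]] := g_real (ltW lts).
have := pmin v (b + c * `|x - v| ^+ 2); move: lts.
rewrite /obj gv -EFinD lte_fin lexx -/c => lts /(_ isT).
by rewrite leNgt lts.
Qed.

(** Compare the minimizer [p] with [s u + (1 - s) p], divide by [s] and let [s -> 0]. *)
Lemma prox_subdiff x :
  subdiff g (prox t g x) (t^-1 *: (x - prox t g x)).
Proof.
have hp : forall v, (obj x (prox t g x) <= obj x v)%E.
  exact: (@getPex _ [set u | forall v, (obj x u <= obj x v)%E] (prox_exists x)).
move: (prox t g x) hp => p hp u /=.
have [x0 [a0 g0]] := real_point.
have [a [gp _]] : exists a, g p = a%:E /\ a + (2 * t)^-1 * `|x - p| ^+ 2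
    <= a0 + (2 * t)^-1 * `|x - x0| ^+ 2.
  by apply: g_real; have := hp x0; rewrite {2}/obj g0 -EFinD.
have [/(_ u) gu0 _] := g_proper.
case gu : (g u) gu0 => [b| |] // _; last by rewrite leey.
rewrite gp -EFinD lee_fin.
apply: (@ler_of_small _ _ _ ((2 * t)^-1 * '[u - p, u - p])) => s s0 s1.
have [d [gd dle]] := g_convexR s0 s1 gu gp.
have := hp (s *: u + (1 - s) *: p); rewrite /obj gp gd -!EFinD lee_fin.
have e2 : t^-1 = 2 * (2 * t)^-1 by rewrite invfM mulrA mulfV ?mul1r.
rewrite -!hdotE e2; move: dle; move: (2 * t)^-1 => c dle h.
rewrite -(ler_pM2l s0).
have xE : x - (s *: u + (1 - s) *: p) = (x - p) - s *: (u - p).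
  rewrite scalerBl scale1r scalerBr !opprD !opprK.
  by rewrite [LHS](AC (1*(1*(1*1))) ((1*3)*(2*4))).
move: h; rewrite xE; move: (x - p) (u - p) => y z.
by rewrite !(ipE hip) (hdotC z y); lra.
Qed.

End Prox.

(** * The relaxed inertial fixed-point iteration for a cocoercive [id - T] *)

Section KrasnoselskiiMann.
Variables (R : realType) (H : lmodType R) (ip : H -> H -> R).
Hypotheses (hip : inner_product ip) (hcomplete : ip_complete ip).
Variables (T : H -> H) (kappa w e s0 s1 nu0 : R).
Hypotheses (w_gt0 : 0 < w) (w_kappa : w < kappa) (kappa_ge : 2^-1 <= kappa).
Hypotheses (s1_gt0 : 0 < s1) (s1s0 : s1 < s0) (s0e : s0 < e).
Hypothesis nu0_ge0 : 0 <= nu0.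

Let U z := z - T z.

Hypothesis U_coercive : forall z z',
  kappa * ip (U z - U z') (U z - U z') <= ip (U z - U z') (z - z').
Variables (q : H) (z zeta : nat -> H).
Hypothesis T_q : T q = q.
Hypothesis zS : forall n, z n.+1 = (1 - w) *: zeta n + w *: T (zeta n).
Hypothesis zetaS : forall n, zeta n.+1 = z n.+1
  + theta e s1 nu0 n.+1 *: (z n.+1 - z n)
  + gamma e s0 s1 nu0 n.+1 *: (zeta n - z n.+1).

Let ipC := ip_sym hip.
Let d n := z n.+1 - z n.
Let g n := zeta n - z n.+1.

Let kappa_gt0 : 0 < kappa. Proof. exact: lt_trans w_kappa. Qed.

Let gE n : g n = w *: U (zeta n).
Proof.
rewrite /g zS /U scalerBl scale1r scalerBr opprD opprB addrA.
by rewrite addrCA subrr addr0.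
Qed.

Let rho := kappa / w - 1.

Let rho_gt0 : 0 < rho.
Proof. by rewrite /rho subr_gt0 ltr_pdivlMr ?mul1r. Qed.

(** [w U] is [kappa / w]-cocoercive at [zeta]; passing to the relaxed point [zeta - w U zeta] costs
    exactly 1, and [w < kappa] keeps the constant positive. Both sign conditions of the inertial
    analysis are instances. *)
Let coercive_step a b :
  rho * ip (w *: U a - w *: U b) (w *: U a - w *: U b) <=
  ip ((a - w *: U a) - (b - w *: U b)) (w *: U a - w *: U b).
Proof.
have -> : a - w *: U a - (b - w *: U b) = (a - b) - (w *: U a - w *: U b).
  by rewrite !opprB [LHS](AC (2*2) ((1*4)*(3*2))).
rewrite -scalerBr (ipDl hip) (ipNl hip) lerBrDr /rho mulrBl mul1r subrK.
have := U_coercive a b; rewrite !(ipZl hip, ipZr hip) (ipC _ (a - b)).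
move: (ip _ _) (ip (a - b) _) => u v h.
have -> : kappa / w * (w * (w * u)) = w * (kappa * u) by field; rewrite gt_eqF.
by rewrite ler_wpM2l // ltW.
Qed.

Let zE n : z n.+1 = zeta n - w *: U (zeta n).
Proof. by rewrite -gE /g opprB addrC subrK. Qed.

Let positive_step p n : T p = p -> 0 <= ip (z n.+1 - p) (g n).
Proof.
move=> Tp.
have := coercive_step (zeta n) p.
have -> : U p = 0 by rewrite /U Tp subrr.
rewrite scaler0 !subr0.
rewrite -zE -gE; apply: le_trans.
by rewrite mulr_ge0 ?ip_pos // ltW.
Qed.

(* The sequences are shifted by one step, hence [nu0 + s1]: the residual
   [zeta_{-1} - z_0] is arbitrary and has no sign property. *)
Let dg_step n : d n.+1 + g n.+1 = theta e s1 (nu0 + s1) n *: d n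
  + gamma e s0 s1 (nu0 + s1) n *: g n.
Proof.
have nuE : nu s1 (nu0 + s1) n.+1 = nu s1 nu0 n.+2.
  by rewrite /nu -[n.+2%:R]natr1; ring.
rewrite /theta /gamma nuE /d /g addrC subrKA zetaS.
by rewrite -[X in X - _]addrA [LHS]addrC addKr.
Qed.

Let dg_coercive n :
  rho * ip (g n.+1 - g n) (g n.+1 - g n) <= ip (d n.+1) (g n.+1 - g n).
Proof. by have := coercive_step (zeta n.+1) (zeta n); rewrite -!zE -!gE. Qed.

Let nu1_ge0 : 0 <= nu0 + s1. Proof. by rewrite addr_ge0 // ltW. Qed.

Let xS p n : z n.+2 - p = z n.+1 - p + d n.+1.
Proof. by rewrite /d [RHS]addrC subrKA. Qed.

Let sum_d := inertial_sum_velocity hip s1_gt0 s1s0 s0e nu1_ge0 rho_gt0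
  (xS q) dg_step (fun n => positive_step n T_q) dg_coercive.
Let sum_g := inertial_sum_residual hip s1_gt0 s1s0 s0e nu1_ge0 rho_gt0
  (xS q) dg_step (fun n => positive_step n T_q) dg_coercive.
Let cvg_d := inertial_cvg_velocity hip s1_gt0 s1s0 s0e nu1_ge0 rho_gt0
  (xS q) dg_step (fun n => positive_step n T_q) dg_coercive.
Let cvg_g := inertial_cvg_residual hip s1_gt0 s1s0 s0e nu1_ge0 rho_gt0
  (xS q) dg_step (fun n => positive_step n T_q) dg_coercive.

Lemma km_cvg_velocity :
  (fun n => n.+1%:R ^+ 2 * ip (z n.+1 - z n) (z n.+1 - z n)) @ \oo --> (0 : R).
Proof. exact: cvg_d. Qed.

Lemma km_sum_velocity :
  bounded_sums (fun n => n.+1%:R * ip (z n.+1 - z n) (z n.+1 - z n)).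
Proof. exact: sum_d. Qed.

Lemma km_sum_acceleration : bounded_sums (fun n => n.+1%:R ^+ 2 *
  ip (z n.+2 - z n.+1 - (z n.+1 - z n)) (z n.+2 - z n.+1 - (z n.+1 - z n))).
Proof.
exact: (inertial_sum_acceleration hip s1_gt0 s1s0 s0e nu1_ge0 rho_gt0
  (xS q) dg_step (fun n => positive_step n T_q) dg_coercive).
Qed.

Let U_lipschitz a b :
  ip (U a - U b) (U a - U b) <= kappa^-1 ^+ 2 * ip (a - b) (a - b).
Proof.
have := ip_le_half hip (kappa *: (U a - U b)) (a - b).
have := U_coercive a b; rewrite !(ipZl hip, ipZr hip) => h1 h2.
rewrite exprVn ler_pdivlMl ?exprn_gt0 //.
have : kappa * (kappa * ip (U a - U b) (U a - U b)) <=
    kappa * ip (U a - U b) (a - b) by rewrite ler_wpM2l // ltW.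
by lra.
Qed.

(** The residual at [z] is compared with that at [zeta]: [U zeta = g / w] gives the first term, and
    [zeta - z = d + g] with the Lipschitz bound of [U] gives the second. *)
Let C := 2 * w^-1 ^+ 2 + 4 * kappa^-1 ^+ 2.

Let C_ge0 : 0 <= C.
Proof. by rewrite addr_ge0 // mulr_ge0 // sqr_ge0. Qed.

Let residual_le n : ip (T (z n) - z n) (T (z n) - z n) <=
  C * (ip (d n) (d n) + ip (g n) (g n)).
Proof.
have -> : T (z n) - z n = (U (zeta n) - U (z n)) - U (zeta n).
  by rewrite addrAC subrr add0r /U opprB.
apply: le_trans (ip_normD_le2 hip _ _) _.
rewrite (ipNl hip) (ipNr hip) opprK.
have h1 := U_lipschitz (zeta n) (z n).
have h2 : ip (zeta n - z n) (zeta n - z n) <= 2 * ip (d n) (d n) + 2 * ip (g n) (g n).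
  have -> : zeta n - z n = d n + g n by rewrite /d /g [RHS]addrC subrKA.
  exact: ip_normD_le2.
have h3 : ip (U (zeta n)) (U (zeta n)) = w^-1 ^+ 2 * ip (g n) (g n).
  by rewrite gE (ipZl hip) (ipZr hip) expr2 -!mulrA !mulKf // gt_eqF.
have h4 : kappa^-1 ^+ 2 * ip (zeta n - z n) (zeta n - z n) <=
    kappa^-1 ^+ 2 * (2 * ip (d n) (d n) + 2 * ip (g n) (g n)).
  by rewrite ler_wpM2l ?sqr_ge0.
have h5 : 0 <= w^-1 ^+ 2 * ip (d n) (d n) by rewrite mulr_ge0 ?sqr_ge0 ?ip_pos.
by rewrite h3 /C; lra.
Qed.

Lemma km_cvg_residual :
  (fun n => n.+1%:R ^+ 2 * ip (T (z n) - z n) (T (z n) - z n)) @ \oo --> (0 : R).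
Proof.
have : (fun n => C * (n.+1%:R ^+ 2 * ip (d n) (d n) + n.+1%:R ^+ 2 * ip (g n) (g n)))
    @ \oo --> C * (0 + 0 : R).
  by apply: cvgMr; exact: cvgD cvg_d cvg_g.
rewrite addr0 mulr0; apply: squeeze_cvgr (cvg_cst 0).
apply: nearW => n; rewrite mulr_ge0 ?sqr_ge0 ?ip_pos //=.
by rewrite -mulrDr mulrCA ler_wpM2l ?sqr_ge0.
Qed.

Lemma km_sum_residual :
  bounded_sums (fun n => n.+1%:R * ip (T (z n) - z n) (T (z n) - z n)).
Proof.
apply: bounded_sums_le (bounded_sumsZ C_ge0 (bounded_sumsD sum_d sum_g)) => n.
by rewrite -mulrDr mulrCA ler_wpM2l.
Qed.

(** Expanding the square leaves [|a - b|^2 - (2 kappa - 1) |U a - U b|^2] as an upper bound, and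
    [kappa >= 1/2]. *)
Let T_nonexpansive a b : ip (T a - T b) (T a - T b) <= ip (a - b) (a - b).
Proof.
have TE : T a - T b = (a - b) - (U a - U b).
  by rewrite /U !opprB [RHS](AC (2*(2*2)) ((5*4)*((1*6)*(3*2)))) /= !subrr !addr0.
have := U_coercive a b; rewrite TE.
move: (U a - U b) (a - b) => u v h; have := ip_pos hip u.
rewrite !(ipE hip) (ipC v u); move: h kappa_ge; nra.
Qed.

Lemma km_weak_limit :
  exists2 c, T c = c & forall v, (fun n => ip (z n) v) @ \oo --> ip c v.
Proof.
have [B hB] := inertial_position_bounded hip s1_gt0 s1s0 s0e nu1_ge0 rho_gt0
  (xS q) dg_step (fun n => positive_step n T_q) dg_coercive.
(* The shift matches the inertial positions [z n.+1 - q]. *)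
have [| |p Tp|c Tc hc] := @opial_weak_limit _ _ _ hip hcomplete T (fun n => z n.+1)
    (2 * B + 2 * ip q q) _ T_nonexpansive.
- move=> n; rewrite -[z n.+1](subrK q); apply: le_trans (ip_normD_le2 hip _ _) _.
  by rewrite lerD2r ler_pM2l.
- have res : (fun n => ip (T (z n) - z n) (T (z n) - z n)) @ \oo --> (0 : R).
    have := km_cvg_residual; apply: squeeze_cvgr (cvg_cst 0); apply: nearW => n.
    by rewrite ip_pos //= ler_peMl ?ip_pos // exprn_ege1 // ler1n.
  by move: res; rewrite -cvg_shiftS.
- exact: (inertial_cvg_position hip s1_gt0 s1s0 s0e nu1_ge0 rho_gt0
    (xS p) dg_step (fun n => positive_step n Tp) dg_coercive).
by exists c => // v; rewrite -cvg_shiftS; exact: hc.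
Qed.

End KrasnoselskiiMann.

(** * The primal-dual operator in the metric of [M] *)

Lemma subdiff_monotone (R : realType) (X : hilbertType R) (g : X -> \bar R) x y p q :
  proper_efun g -> subdiff g x p -> subdiff g y q -> 0 <= '[p - q, x - y].
Proof.
move=> [gN [x0 gx0]] hp hq.
(* A subgradient at [u], tested at a point where [g] is finite, excludes [g u = +oo]. *)
have fin u r : subdiff g u r -> exists a, g u = a%:E.
  move=> hr; exists (fine (g u)); rewrite fineK // fin_real // gN /=.
  apply: le_lt_trans (_ : (g x0 - ('[r, x0 - u])%:E < +oo)%E).
    by rewrite leeBrDr //; exact: hr.
  by rewrite lte_add_pinfty // ltry.
have [a ga] := fin _ _ hp; have [b gb] := fin _ _ hq.
have := hp y; have := hq x; rewrite ga gb -!EFinD !lee_fin.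
have hip := hdot_inner_product X.
by rewrite !(ipE hip); lra.
Qed.

Lemma hdot_sub_sum3 (R : realType) (V : hilbertType R) (a b c a' b' c' v : V) :
  '[a - b - c - (a' - b' - c'), v] =
  '[a - a', v] - '[b - b', v] - '[c - c', v].
Proof.
have hV := hdot_inner_product V.
rewrite -!(ipNl hV) -!(ipDl hV); congr ('[_, v]).
by rewrite !opprD !opprK [LHS](AC (3*3) ((1*4)*(2*5)*(3*6))).
Qed.

Section PrimalDual.
Variables (R : realType) (X Y : hilbertType R) (K : {linear X -> Y}).
Hypothesis K_bounded : bounded_near K (nbhs (0 : X)).
Variables (tau sigma lx ly : R).
Hypotheses (lx_gt0 : 0 < lx) (ly_gt0 : 0 < ly).
Hypotheses (tau_gt0 : 0 < tau) (sigma_gt0 : 0 < sigma).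
Hypotheses (lx_tau : lx < tau^-1) (ly_sigma : ly < sigma^-1).
Hypothesis K_small : opnorm K ^+ 2 < (tau^-1 - lx) * (sigma^-1 - ly).

Let hX := hdot_inner_product X.
Let hY := hdot_inner_product Y.

Definition ipM (z z' : X * Y) : R := pdot (opM K tau sigma z) z'.

Lemma ipME z z' : ipM z z' = tau^-1 * '[z.1, z'.1] - '[K z'.1, z.2]
  - '[K z.1, z'.2] + sigma^-1 * '[z.2, z'.2].
Proof.
rewrite /ipM /pdot /opM /= !(ipE hX) !(ipE hY).
by rewrite (hdotC (adjoint K z.2)) -adjointE //; ring.
Qed.

(** [K_small] bounds the operator norm by [sqrt (p q)], and [2 sqrt (p q) |x| |y| <= p |x|^2 + q
    |y|^2]. The reserved margins [lx], [ly] later pay for the gradients. *)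
Let cross_le x y : 2 * `|'[K x, y]| <=
  (tau^-1 - lx) * '[x, x] + (sigma^-1 - ly) * '[y, y].
Proof.
have p0 : 0 < tau^-1 - lx by rewrite subr_gt0.
have q0 : 0 < sigma^-1 - ly by rewrite subr_gt0.
move: K_small p0 q0; move: (tau^-1 - lx) (sigma^-1 - ly) => p q hK p0 q0.
have k0 := opnorm_ge0 K_bounded.
have h1 : `|'[K x, y]| <= opnorm K * `|x| * `|y|.
  have h2 : `|K x| * `|y| <= opnorm K * `|x| * `|y|.
    by rewrite ler_wpM2r // le_opnorm.
  rewrite ler_norml; apply/andP; split; last exact: le_trans (hdot_le_norm _ _) h2.
  rewrite lerNl -(ipNl hY); apply: le_trans (hdot_le_norm _ _) _.
  by rewrite normrN.
have sp := sqr_sqrtr (ltW p0); have sq := sqr_sqrtr (ltW q0).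
have sp0 := sqrtr_ge0 p; have sq0 := sqrtr_ge0 q.
have h3 : opnorm K <= Num.sqrt p * Num.sqrt q.
  rewrite -ler_sqr ?nnegrE ?mulr_ge0 // exprMn sp sq; exact: ltW.
rewrite !hdotE; apply: le_trans (_ : 2 * (Num.sqrt p * Num.sqrt q * (`|x| * `|y|)) <= _).
  rewrite ler_pM2l //; apply: le_trans h1 _; rewrite -mulrA.
  by rewrite ler_wpM2r // mulr_ge0.
rewrite -{2}sp -{2}sq.
by have := sqr_ge0 (Num.sqrt p * `|x| - Num.sqrt q * `|y|); lra.
Qed.

Lemma ipM_ge z : lx * '[z.1, z.1] + ly * '[z.2, z.2] <= ipM z z.
Proof.
rewrite ipME; have := cross_le z.1 z.2; have := ler_norm '[K z.1, z.2]; lra.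
Qed.

Lemma ipM_le z : ipM z z <= 2 * tau^-1 * '[z.1, z.1] + 2 * sigma^-1 * '[z.2, z.2].
Proof.
rewrite ipME; have := cross_le z.1 z.2; have := ler_norm (- '[K z.1, z.2]); rewrite normrN.
have := mulr_ge0 (ltW lx_gt0) (ip_pos hX z.1).
have := mulr_ge0 (ltW ly_gt0) (ip_pos hY z.2); lra.
Qed.

Lemma ipM_inner_product : inner_product ipM.
Proof.
split=> [z z'|z z' z''|a z z'|z|z].
- by rewrite !ipME (hdotC z'.1) (hdotC z'.2); ring.
- by rewrite !ipME /= !(linearD K) !(ipE hX) !(ipE hY); ring.
- by rewrite !ipME /= !(linearZ_LR K) !(ipE hX) !(ipE hY); ring.
- apply: le_trans (ipM_ge z).
  by rewrite addr_ge0 // mulr_ge0 ?(ltW lx_gt0) ?(ltW ly_gt0) ?(ip_pos hX) ?(ip_pos hY).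
move=> z0; have := ipM_ge z; rewrite z0 => h.
have h1 := ip_pos hX z.1; have h2 := ip_pos hY z.2.
have h3 : 0 <= lx * '[z.1, z.1] by rewrite mulr_ge0 // ltW.
have h4 : 0 <= ly * '[z.2, z.2] by rewrite mulr_ge0 // ltW.
have e1 : '[z.1, z.1] = 0.
  by apply/(mulfI (lt0r_neq0 lx_gt0)); rewrite mulr0; lra.
have e2 : '[z.2, z.2] = 0.
  by apply/(mulfI (lt0r_neq0 ly_gt0)); rewrite mulr0; lra.
by rewrite [z]surjective_pairing (ip_definite hX e1) (ip_definite hY e2).
Qed.

Lemma ipM_complete : ip_complete ipM.
Proof.
move=> u hu.
have [|lX hlX] := @hdot_complete R X (fun n => (u n).1).
  move=> eps e0; have [|N hN] := hu (lx * eps); first by rewrite mulr_gt0.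
  exists N => m n Nm Nn; rewrite -(ler_pM2l lx_gt0).
  apply: le_trans (hN m n Nm Nn); apply: le_trans (ipM_ge _).
  by rewrite lerDl mulr_ge0 ?(ltW ly_gt0) ?(ip_pos hY).
have [|lY hlY] := @hdot_complete R Y (fun n => (u n).2).
  move=> eps e0; have [|N hN] := hu (ly * eps); first by rewrite mulr_gt0.
  exists N => m n Nm Nn; rewrite -(ler_pM2l ly_gt0).
  apply: le_trans (hN m n Nm Nn); apply: le_trans (ipM_ge _).
  by rewrite lerDr mulr_ge0 ?(ltW lx_gt0) ?(ip_pos hX).
exists (lX, lY) => eps e0.
have [|N1 h1] := hlX (eps * tau / 4); first by rewrite divr_gt0 ?mulr_gt0.
have [|N2 h2] := hlY (eps * sigma / 4); first by rewrite divr_gt0 ?mulr_gt0.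
exists (maxn N1 N2) => n; rewrite geq_max => /andP[n1 n2].
apply: le_trans (ipM_le _) _ => /=.
have k1 : tau^-1 * '[(u n).1 - lX, (u n).1 - lX] <= eps / 4.
  by rewrite ler_pdivrMl // mulrA (mulrC tau); exact: h1.
have k2 : sigma^-1 * '[(u n).2 - lY, (u n).2 - lY] <= eps / 4.
  by rewrite ler_pdivrMl // mulrA (mulrC sigma); exact: h2.
by lra.
Qed.

Lemma normM_sqr z : normM K tau sigma z ^+ 2 = ipM z z.
Proof. by rewrite /normM sqr_sqrtr // (ip_pos ipM_inner_product). Qed.

(** The max norm is dominated by the [M]-norm, so a continuous form is bounded for the latter and
    Riesz representation applies in the [M]-scalar product. *)
Lemma weakly_cvg_ipM (u : nat -> X * Y) (c : X * Y) :
  (forall v, (fun n => ipM (u n) v) @ \oo --> ipM c v) -> weakly_cvg u c.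
Proof.
move=> hu f fc.
have [C C0 hC] : exists2 C, 0 < C & forall z, `|f z| <= C * `|z|.
  have /continuous_linear_bounded/linear_boundedP : {for 0, continuous f} by exact: fc.
  by move=> /pinfty_ex_gt0[C C0 hC]; exists C.
pose m := Num.min lx ly; have m0 : 0 < m by rewrite lt_min lx_gt0.
have sm0 : 0 < Num.sqrt m by rewrite sqrtr_gt0.
have normle (z : X * Y) : `|z| <= (Num.sqrt m)^-1 * Num.sqrt (ipM z z).
  rewrite ler_pdivlMl // -ler_sqr ?nnegrE ?mulr_ge0 ?(ltW sm0) //.
  rewrite exprMn !sqr_sqrtr ?(ltW m0) ?(ip_pos ipM_inner_product) //.
  apply: le_trans (ipM_ge z); rewrite !hdotE.
  have h1 : m * `|z.1| ^+ 2 <= lx * `|z.1| ^+ 2.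
    by rewrite ler_wpM2r ?sqr_ge0 // ge_min lexx.
  have h2 : m * `|z.2| ^+ 2 <= ly * `|z.2| ^+ 2.
    by rewrite ler_wpM2r ?sqr_ge0 // ge_min lexx orbT.
  have h3 : 0 <= m * `|z.1| ^+ 2 by rewrite mulr_ge0 ?sqr_ge0 // ltW.
  have h4 : 0 <= m * `|z.2| ^+ 2 by rewrite mulr_ge0 ?sqr_ge0 // ltW.
  have -> : `|z| = Num.max `|z.1| `|z.2| by [].
  by case: (leP `|z.1| `|z.2|) => _; lra.
have [|||v hv] := @riesz_representation _ _ _ ipM_inner_product ipM_complete f
    (C * (Num.sqrt m)^-1).
- exact: linearD.
- by move=> a z; rewrite linearZ.
- move=> z; apply: le_trans (ler_norm _) _; apply: le_trans (hC z) _.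
  by rewrite -mulrA ler_pM2l.
have -> : f \o u = (fun n => ipM (u n) v) by apply/funext => n /=.
by rewrite hv.
Qed.

Variables (G : X -> \bar R) (Fs : Y -> \bar R) (Q : X -> R) (Ps : Y -> R).
Hypotheses (G_proper : proper_efun G) (G_convex : convex_efun G).
Hypothesis G_lsc : lower_semicontinuous G.
Hypotheses (Fs_proper : proper_efun Fs) (Fs_convex : convex_efun Fs).
Hypothesis Fs_lsc : lower_semicontinuous Fs.
Variables (lQ lP c : R).
Hypotheses (lQ_gt0 : 0 < lQ) (lP_gt0 : 0 < lP) (c_gt0 : 0 < c) (c_lt1 : c < 1).
Hypotheses (lQ_lx : lQ <= 4 * c * lx) (lP_ly : lP <= 4 * c * ly).
Hypothesis Q_cocoercive : forall x x',
  '[grad Q x - grad Q x', grad Q x - grad Q x'] <=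
  lQ * '[grad Q x - grad Q x', x - x'].
Hypothesis Ps_cocoercive : forall y y',
  '[grad Ps y - grad Ps y', grad Ps y - grad Ps y'] <=
  lP * '[grad Ps y - grad Ps y', y - y'].

Let T := opT K tau sigma G Fs Q Ps.

(** The inclusion defining [T] as a relation, usable before existence and uniqueness of [t] are
    known. *)
Definition resolvent_step (z t : X * Y) :=
  [set opM K tau sigma t + a | a in opA K G Fs t]
    (opM K tau sigma z - opB Q Ps z).

(** The off-diagonal part of [M] cancels the adjoint term at [t.2], so the system is triangular:
    [t.1] comes first, then [t.2] with the extrapolation [2 t.1 - z.1]. *)
Lemma resolvent_stepP z t : resolvent_step z t <->
  subdiff G t.1 (tau^-1 *: (z.1 - t.1) - adjoint K z.2 - grad Q z.1) /\
  subdiff Fs t.2 (sigma^-1 *: (z.2 - t.2) + 2 *: K t.1 - K z.1 - grad Ps z.2).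
Proof.
split.
  move=> [a [[p hp e1] [q hq e2]] /pair_equal_spec[]] /=; rewrite -e1 -e2 => E1 E2.
  split.
    suff -> : tau^-1 *: (z.1 - t.1) - adjoint K z.2 - grad Q z.1 = p by [].
    rewrite scalerBr -[RHS](addrK (tau^-1 *: t.1)).
    have -> : p + tau^-1 *: t.1 = tau^-1 *: t.1 - adjoint K t.2 + (p + adjoint K t.2).
      by rewrite [RHS](AC (2*2) (3*1*(4*2))) /= subrr addr0.
    by rewrite E1 [LHS](AC (2*1*1) (1*3*4*2)).
  suff -> : sigma^-1 *: (z.2 - t.2) + 2 *: K t.1 - K z.1 - grad Ps z.2 = q by [].
  have qE : q = 2 *: K t.1 - sigma^-1 *: t.2 +
      (- K t.1 + sigma^-1 *: t.2 + (- K t.1 + q)).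
    rewrite scaler_nat mulr2n [RHS](AC (2*1*(2*2)) ((1*4)*(2*6)*(5*3)*7)).
    by rewrite /= !subrr !add0r.
  rewrite qE E2 scalerBr.
  by rewrite [LHS](AC (2*1*1*1) (3*2*(4*1*5))).
move=> [h1 h2].
exists ((tau^-1 *: (z.1 - t.1) - adjoint K z.2 - grad Q z.1) + adjoint K t.2,
  - K t.1 + (sigma^-1 *: (z.2 - t.2) + 2 *: K t.1 - K z.1 - grad Ps z.2)).
  by split; [exists (tau^-1 *: (z.1 - t.1) - adjoint K z.2 - grad Q z.1)|
    exists (sigma^-1 *: (z.2 - t.2) + 2 *: K t.1 - K z.1 - grad Ps z.2)].
congr (_, _) => /=.
  rewrite scalerBr [LHS](AC (2*(2*1*1*1)) (3*(1*4)*(2*7)*5*6)) /=.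
  by rewrite subrr addNr !addr0.
rewrite scaler_nat mulr2n scalerBr.
rewrite [LHS](AC (2*(1*(2*2*1*1))) ((1*6)*(3*7)*(2*5)*8*4*9)) /=.
by rewrite !addNr subrr !add0r.
Qed.

Lemma resolvent_step_prox z t :
  t.1 = prox tau G (z.1 - tau *: (grad Q z.1 + adjoint K z.2)) ->
  t.2 = prox sigma Fs (z.2 - sigma *: (grad Ps z.2 - K (2 *: t.1 - z.1))) ->
  resolvent_step z t.
Proof.
move=> e1 e2; apply/resolvent_stepP; split.
  have := prox_subdiff G_proper G_convex G_lsc tau_gt0
    (z.1 - tau *: (grad Q z.1 + adjoint K z.2)).
  rewrite -e1; congr (subdiff G t.1 _).
  rewrite !scalerBr scalerA mulVf ?gt_eqF // scale1r opprD.
  by rewrite [LHS](AC (1*2*1) (1*4*3*2)).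
have := prox_subdiff Fs_proper Fs_convex Fs_lsc sigma_gt0
  (z.2 - sigma *: (grad Ps z.2 - K (2 *: t.1 - z.1))).
rewrite -e2; congr (subdiff Fs t.2 _).
rewrite !(scalerBr sigma^-1) scalerA mulVf ?gt_eqF // scale1r (linearB K) (linearZ_LR K) !opprB.
by rewrite [LHS](AC (1*(2*1)*1) (1*5*2*3*4)).
Qed.

(** Expand [|b - (l / 2) (d - s)|^2 >= 0]. The gradient increment [b] is taken at the old points but
    paired with the new ones; the loss [l / 4] is the origin of the factor [1/4] in the first
    step-size condition. *)
Let cocoercive_defect (V : hilbertType R) (b d s : V) l : 0 < l ->
  '[b, b] <= l * '[b, d] -> - (l / 4) * '[d - s, d - s] <= '[b, s].
Proof.
have hV := hdot_inner_product V.
move=> l0 h; rewrite -(ler_pM2l l0).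
have := ip_pos hV (b - (l / 2) *: (d - s)).
move: h; have -> : '[b, s] = '[b, d] - '[b, d - s] by rewrite (ipE hV) (ipE hV); ring.
move: (d - s) => r; rewrite !(ipE hV) (hdotC r b); lra.
Qed.

(** Monotonicity of both subdifferentials bounds [ipM (d - s) s] below by the gradient terms; these
    lose at most [c (lx |.|^2 + ly |.|^2)], hence at most [c] times the squared [M]-norm of
    [d - s]. *)
Lemma resolvent_step_coercive z z' t t' :
  resolvent_step z t -> resolvent_step z' t' ->
  (1 - c) * ipM ((z - t) - (z' - t')) ((z - t) - (z' - t')) <=
  ipM ((z - t) - (z' - t')) (z - z').
Proof.
move=> /resolvent_stepP[a1 a2] /resolvent_stepP[b1 b2].
have := subdiff_monotone G_proper a1 b1; have := subdiff_monotone Fs_proper a2 b2.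
have := Q_cocoercive z.1 z'.1; have := Ps_cocoercive z.2 z'.2.
pose d := z - z'; pose s := t - t'.
have -> : z - t - (z' - t') = d - s.
  by rewrite /d /s !opprB [LHS](AC (2*2) ((1*4)*(3*2))).
have F1 : z.1 - z'.1 = d.1 by [].
have F2 : z.2 - z'.2 = d.2 by [].
have F3 : t.1 - t'.1 = s.1 by [].
have F4 : t.2 - t'.2 = s.2 by [].
rewrite F1 F2 F3 F4 -/d; clearbody d s.
set bP := grad Ps z.2 - _; set bQ := grad Q z.1 - _ => hP hQ m2 m1.
have k1 := cocoercive_defect s.1 lQ_gt0 hQ.
have k2 := cocoercive_defect s.2 lP_gt0 hP.
have m1E : 0 <= tau^-1 * '[d.1 - s.1, s.1] - '[K s.1, d.2] - '[bQ, s.1].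
  have e1 : z.1 - t.1 - (z'.1 - t'.1) = d.1 - s.1.
    by rewrite -F1 -F3 !opprB [LHS](AC (2*2) ((1*4)*(3*2))).
  have e2 : '[adjoint K z.2 - adjoint K z'.2, s.1] = '[K s.1, d.2].
    by rewrite hdotC (ipDr hX) (ipNr hX) -!adjointE // -F2 (ipDr hY) (ipNr hY).
  by move: m1; rewrite hdot_sub_sum3 -scalerBr (ipZl hX) e1 e2.
have m2E : 0 <= sigma^-1 * '[d.2 - s.2, s.2] + 2 * '[K s.1, s.2]
    - '[K d.1, s.2] - '[bP, s.2].
  have e1 : z.2 - t.2 - (z'.2 - t'.2) = d.2 - s.2.
    by rewrite -F2 -F4 !opprB [LHS](AC (2*2) ((1*4)*(3*2))).
  move: m2; rewrite hdot_sub_sum3 opprD addrACA -!scalerBr -!(linearB K) e1 F1 F3.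
  by rewrite (ipDl hY) !(ipZl hY).
have := ipM_ge (d - s).
have dsE : ipM (d - s) d = ipM (d - s) s + ipM (d - s) (d - s).
  by rewrite -(ipDr ipM_inner_product) [s + _]addrC subrK.
have dsS : '[bQ, s.1] + '[bP, s.2] <= ipM (d - s) s.
  apply: le_trans (_ : _ <= (tau^-1 * '[d.1 - s.1, s.1] - '[K s.1, d.2])
   + (sigma^-1 * '[d.2 - s.2, s.2] + 2 * '[K s.1, s.2] - '[K d.1, s.2])) _; first lra.
  rewrite ipME /= (linearB K) !(ipE hX) !(ipE hY); lra.
rewrite dsE /=.
have j1 : lQ / 4 * '[d.1 - s.1, d.1 - s.1] <= c * lx * '[d.1 - s.1, d.1 - s.1].
  by rewrite ler_wpM2r ?(ip_pos hX) //; move: lQ_lx; lra.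
have j2 : lP / 4 * '[d.2 - s.2, d.2 - s.2] <= c * ly * '[d.2 - s.2, d.2 - s.2].
  by rewrite ler_wpM2r ?(ip_pos hY) //; move: lP_ly; lra.
move=> h0.
have h1 : c * (lx * '[d.1 - s.1, d.1 - s.1] + ly * '[d.2 - s.2, d.2 - s.2])
    <= c * ipM (d - s) (d - s) by rewrite ler_wpM2l // ltW.
by lra.
Qed.

(** Coercivity at equal arguments gives [(1 - c) |t - t'|^2 <= 0] in the metric of [M]; this
    identifies the value chosen by [get] in [opT]. *)
Lemma resolvent_step_unique z t t' :
  resolvent_step z t -> resolvent_step z t' -> t = t'.
Proof.
move=> h h'; have := resolvent_step_coercive h h'.
rewrite subrr (_ : ipM _ 0 = 0); last first.
  by rewrite -(scale0r 0) (ipZr ipM_inner_product) mul0r.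
rewrite opprB [z - t + _]addrC subrKA pmulr_rle0; last by rewrite subr_gt0.
move=> h0; apply/esym/subr0_eq/(ip_definite ipM_inner_product)/eqP.
by rewrite eq_le h0 (ip_pos ipM_inner_product).
Qed.

Lemma opT_step z : resolvent_step z (T z).
Proof.
rewrite /T /opT; apply: (@getPex _ [set t | resolvent_step z t]).
exists (prox tau G (z.1 - tau *: (grad Q z.1 + adjoint K z.2)),
  prox sigma Fs (z.2 - sigma *: (grad Ps z.2 - K (2 *:
    prox tau G (z.1 - tau *: (grad Q z.1 + adjoint K z.2)) - z.1)))).
exact: resolvent_step_prox.
Qed.

Lemma opT_eq z t : resolvent_step z t -> T z = t.
Proof. by apply: resolvent_step_unique; exact: opT_step. Qed.

Lemma opT_fixed z : T z = z <-> saddle_sol K G Fs Q Ps z.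
Proof.
split=> [Tz|[a az aB]].
  have [a az aE] := opT_step z; rewrite Tz in az aE; exists a => //.
  move: aE => /addrI ->; exact: addNr.
apply: opT_eq; exists a => //; congr (_ + _).
by apply/eqP; rewrite -addr_eq0; apply/eqP.
Qed.

End PrimalDual.

(** * Step sizes and the convergence theorem *)

Lemma step_size_bounds (R : realType) (k lQ lP c tau sigma : R) :
  0 < c -> 0 < lQ -> 0 < lP -> 0 < tau -> 0 < sigma ->
  (exists delta : R,
     [/\ 4^-1 * Num.max lQ lP < delta,
         tau < c / delta, sigma < c / delta
       & k < (tau^-1 - delta / c) * (sigma^-1 - delta / c)])
   \/
   [/\ tau < c / lQ, sigma < c / lP
     & k < (tau^-1 - lQ / c) * (sigma^-1 - lP / c)] ->
  exists lx ly, [/\ 0 < lx, 0 < ly, lx < tau^-1 & ly < sigma^-1] /\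
    [/\ k < (tau^-1 - lx) * (sigma^-1 - ly), lQ <= 4 * c * lx & lP <= 4 * c * ly].
Proof.
move=> c0 lQ0 lP0 tau0 sigma0.
have inv t l : 0 < t -> 0 < l -> t < c / l -> l / c < t^-1.
  by move=> t0 l0 h; rewrite -[l / c]invf_div ltf_pV2 // posrE divr_gt0.
have c4 l : 4 * c * (l / c) = 4 * l by rewrite -mulrA (mulrC c) divfK // gt_eqF.
(* Both conditions reduce to one: the margins are [delta / c] twice in the first case, [lQ / c] and
   [lP / c] in the second. *)
case=> [[delta [hd ht hs hk]]|[ht hs hk]].
  have hQ : lQ <= Num.max lQ lP by rewrite le_max lexx.
  have hP : lP <= Num.max lQ lP by rewrite le_max lexx orbT.
  have d0 : 0 < delta by lra.
  exists (delta / c), (delta / c); rewrite c4.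
  by split; split; rewrite ?divr_gt0 ?inv //; lra.
exists (lQ / c), (lP / c); rewrite !c4.
by split; split; rewrite ?divr_gt0 ?inv //; lra.
Qed.

Theorem theorem5p3 (R : realType) (X Y : hilbertType R)
  (K : {linear X -> Y}) (G : X -> \bar R) (Fs : Y -> \bar R)
  (Q : X -> R) (Ps : Y -> R) (lQ lP : R)
  (e s0 s1 nu0 w tau sigma : R)
  (xim1 xm1 : X) (chim1 ym1 : Y) (x xi : nat -> X) (y chi : nat -> Y) :
  let M2 (z : X * Y) := normM K tau sigma z ^+ 2 in
  let T := opT K tau sigma G Fs Q Ps in
  let S := saddle_sol K G Fs Q Ps in
  let z (n : nat) : X * Y := (x n, y n) in
  let dz := dotseq (xm1, ym1) z in
  let c := w * (1 - w) in
  bounded_near K (nbhs (0 : X)) ->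
  proper_efun G -> convex_efun G -> lower_semicontinuous G ->
  proper_efun Fs -> convex_efun Fs -> lower_semicontinuous Fs ->
  convex_function (E := X) setT Q ->
  (forall u : X, differentiable (Q : X -> R^o) u) ->
  0 < lQ -> lQ.-lipschitz (grad Q) ->
  convex_function (E := Y) setT Ps ->
  (forall v : Y, differentiable (Ps : Y -> R^o) v) ->
  0 < lP -> lP.-lipschitz (grad Ps) ->
  S !=set0 ->
  0 <= e -> 0 <= s0 -> 0 < s1 -> 0 <= nu0 ->
  0 < tau -> 0 < sigma ->
  0 < w -> w < 1 ->
  2 * s1 < s0 -> s0 < e ->
  ((exists delta : R,
     [/\ 4^-1 * Num.max lQ lP < delta,
         tau < c / delta, sigma < c / delta
       & opnorm K ^+ 2 < (tau^-1 - delta / c) * (sigma^-1 - delta / c)])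
   \/
   [/\ tau < c / lQ, sigma < c / lP
     & opnorm K ^+ 2 < (tau^-1 - lQ / c) * (sigma^-1 - lP / c)]) ->
  cripda K G Fs Q Ps e s0 s1 nu0 w tau sigma xim1 chim1 xm1 ym1 x xi y chi ->
  [/\ [/\ (fun n => M2 (dz n) : R^o) =o_\oo (fun n => n%:R ^- 2 : R^o),
          (\sum_(0 <= n <oo) (n%:R * M2 (dz n))%:E < +oo)%E
        & (\sum_(0 <= n <oo) (n%:R ^+ 2 * M2 (dz n.+1 - dz n))%:E < +oo)%E],
      ((fun n => M2 (T (z n) - z n) : R^o) =o_\oo (fun n => n%:R ^- 2 : R^o)) /\
      (\sum_(0 <= n <oo) (n%:R * M2 (T (z n) - z n))%:E < +oo)%E
    & exists2 zbar : X * Y, S zbar & weakly_cvg z zbar].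
Proof.
move=> M2 T S z dz c Kb Gp Gc Gl Fp Fc Fl Qc Qd lQ0 Qlip Pc Pd lP0 Plip [q Sq].
move=> e0 s00 s10 nu00 tau0 sigma0 w0 w1 s1s0 s0e hcond hz.
have c0 : 0 < c by rewrite mulr_gt0 // subr_gt0.
have [lx [ly [[lx0 ly0 lxt lys] [Ksmall lQx lPy]]]] :=
  step_size_bounds c0 lQ0 lP0 tau0 sigma0 hcond.
have c1 : c <= 4^-1 by have := sqr_ge0 (w - 2^-1); rewrite /c; lra.
have c_lt1 : c < 1 by lra.
(* This gap between the relaxation [w] and the cocoercivity constant [1 - c] makes
   [rho = (1 - c) / w - 1] positive. *)
have wk : w < 1 - c.
  rewrite -subr_gt0; have -> : 1 - c - w = (1 - w) ^+ 2 by rewrite /c; ring.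
  by rewrite exprn_gt0 // subr_gt0.
have k2 : 2^-1 <= 1 - c by lra.
have s1s0' : s1 < s0 by lra.
have hip := ipM_inner_product Kb lx0 ly0 lxt lys Ksmall.
have hco := ipM_complete Kb lx0 ly0 tau0 sigma0 lxt lys Ksmall.
have M2E u : M2 u = ipM K tau sigma u u.
  exact (normM_sqr Kb lx0 ly0 lxt lys Ksmall u).
have Qcoc := baillon_haddad lQ0 Qlip (convex_gradient_ineq Qc Qd).
have Pcoc := baillon_haddad lP0 Plip (convex_gradient_ineq Pc Pd).
have Tstep := opT_step K tau0 sigma0 Q Ps Gp Gc Gl Fp Fc Fl.
have Teq := opT_eq Kb lx0 ly0 tau0 sigma0 lxt lys Ksmall Gp Gc Gl Fp Fc Fl
  lQ0 lP0 c0 c_lt1 lQx lPy Qcoc Pcoc.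
have Tfix := opT_fixed Kb lx0 ly0 tau0 sigma0 lxt lys Ksmall Gp Gc Gl Fp Fc Fl
  lQ0 lP0 c0 c_lt1 lQx lPy Qcoc Pcoc.
have Ucoc u v : (1 - c) * ipM K tau sigma ((u - T u) - (v - T v)) ((u - T u) - (v - T v))
    <= ipM K tau sigma ((u - T u) - (v - T v)) (u - v).
  exact: (resolvent_step_coercive Kb lx0 ly0 lxt lys Ksmall Gp Fp
    lQ0 lP0 c0 lQx lPy Qcoc Pcoc (Tstep u) (Tstep v)).
pose zeta n : X * Y := (xi n, chi n).
have zS n : z n.+1 = (1 - w) *: zeta n + w *: T (zeta n).
  have [_ _ xE yE] := hz n.
  set p := prox tau G _ in xE.
  (* Undoing the relaxation recovers the primal proximal point [p], so [xibar] is the extrapolation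
     [2 p - xi n] required by [T]. *)
  have xbar : (2 * w^-1) *: (x n.+1 - (1 - w) *: xi n) = 2 *: p.
    rewrite xE addrAC subrr add0r scalerA -mulrA mulVf ?mulr1 //.
    exact: lt0r_neq0.
  rewrite xbar in yE; set r := prox sigma Fs _ in yE.
  have -> : T (zeta n) = (p, r).
    by apply: Teq; apply: (resolvent_step_prox tau0 sigma0 Gp Gc Gl Fp Fc Fl).
  by rewrite /z xE yE.
(* From index 1 on, the arbitrary data of index [-1] no longer appear. *)
have zetaS n : zeta n.+1 = z n.+1 + theta e s1 nu0 n.+1 *: (z n.+1 - z n)
    + gamma e s0 s1 nu0 n.+1 *: (zeta n - z n.+1).
  by have [xiE chiE _ _] := hz n.+1; rewrite /zeta xiE chiE.
have Tq : T q = q by apply/Tfix.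
have nn u : 0 <= ipM K tau sigma u u by exact: ip_pos.
have cvd := km_cvg_velocity hip w0 wk s10 s1s0' s0e nu00 Ucoc Tq zS zetaS.
have sumd := km_sum_velocity hip w0 wk s10 s1s0' s0e nu00 Ucoc Tq zS zetaS.
have suma := km_sum_acceleration hip w0 wk s10 s1s0' s0e nu00 Ucoc Tq zS zetaS.
have cvr := km_cvg_residual hip w0 wk s10 s1s0' s0e nu00 Ucoc Tq zS zetaS.
have sumr := km_sum_residual hip w0 wk s10 s1s0' s0e nu00 Ucoc Tq zS zetaS.
have [zbar Tzbar hzbar] :=
  km_weak_limit hip hco w0 wk k2 s10 s1s0' s0e nu00 Ucoc Tq zS zetaS.
split.
- split.
  (* The shift discards [dz 0] and matches [dz n.+1 = z n.+1 - z n]. *)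
  + apply: littleo_inv_sqr; rewrite -cvg_shiftS.
    by under eq_fun do rewrite M2E; exact: cvd.
  + apply: eseries_lt_pinfty => [n|]; first by rewrite mulr_ge0 // M2E.
    apply: bounded_sums_shift; apply: bounded_sums_le sumd => n.
    by rewrite M2E.
  + apply: eseries_lt_pinfty => [n|]; first by rewrite mulr_ge0 ?sqr_ge0 // M2E.
    apply: bounded_sums_shift; apply: bounded_sums_le suma => n.
    by rewrite M2E.
- split.
  + apply: littleo_inv_sqr; move: cvr; apply: squeeze_cvgr (cvg_cst 0).
    apply: nearW => n; rewrite mulr_ge0 ?sqr_ge0 ?M2E //=.
    by rewrite ler_wpM2r // lerXn2r ?nnegrE // ler_nat.
  + apply: eseries_lt_pinfty => [n|]; first by rewrite mulr_ge0 // M2E.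
    apply: bounded_sums_le sumr => n.
    by rewrite M2E ler_wpM2r // ler_nat.
- exists zbar; first exact/Tfix.
  exact: (weakly_cvg_ipM Kb lx0 ly0 tau0 sigma0 lxt lys Ksmall hzbar).
Qed.
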